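(* Let $N\ge1$ and $q\ge1$ be integers, let $\theta>0$ and let $\mathcal{L}$ be a probability distribution on $\mathbb{C}^*$. The $q$-correlation measure $\tilde\mu_N^{[q]}$ associated with the eigenvalues of a random matrix following the distribution $\mathbb{P}(N,\theta,\mathcal{L})$ is given by $$\tilde\mu_N^{[q]}=\sum_{(\lambda_{k,r})_{k,r\ge1}\in\tilde L(N,q)}\left(\prod_{j=1}^{\sum_{k,r\ge1}k\lambda_{k,r}}\frac{N+1-j}{N+\theta-j}\right)\prod_{k,r\ge1}\left[\frac{1}{\lambda_{k,r}!}\left(\frac{\theta}{r!\,k}\right)^{\lambda_{k,r}}\right]\sum_{\sigma\in\Sigma_q}\sigma.\left[\bigotimes_{k\ge1,r\ge1}\left(\mathcal{L}_k^{[r]}\right)^{\otimes\lambda_{k,r}}\right].$$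
   Context: $\Sigma_N$ is the group of permutations of $\{1,\dots,N\}$. For $\sigma\in\Sigma_N$ and $z_1,\dots,z_N\in\mathbb{C}^*$, $M(\sigma,z_1,\dots,z_N)$ is the $N\times N$ matrix $M$ with entries $M_{jk}=z_j\mathbf{1}_{j=\sigma(k)}$. $\mathbb{P}(N,\theta,\mathcal{L})$ is the law of $M(\sigma,z_1,\dots,z_N)$ where $\sigma$ follows the Ewens measure of parameter $\theta$ on $\Sigma_N$ (each permutation has probability proportional to $\theta^n$, $n$ its number of cycles), $z_1,\dots,z_N$ have law $\mathcal{L}$, and $\sigma,z_1,\dots,z_N$ are independent. The $q$-correlation measure $\tilde\mu_N^{[q]}$ is the finite measure on $\mathbb{C}^q$ which is the expectation of the random measure $\mu^{[q]}(M_N)=\sum_{j_1\ne j_2\ne\dots\ne j_q}\delta_{(\omega_{j_1},\dots,\omega_{j_q})}$, where $M_N\sim\mathbb{P}(N,\theta,\mathcal{L})$, $(\omega_j)_{1\le j\le N}$ lists the eigenvalues of $M_N$ with multiplicity, and the sum is over $q$-tuples of pairwise distinct indices in $\{1,\dots,N\}$. $\tilde L(N,q)$ is the set of families $(\lambda_{k,r})_{k,r\ge1}$ of nonnegative integers such that $\sum_{k,r\ge1}r\lambda_{k,r}=q$ and $\sum_{k,r\ge1}k\lambda_{k,r}\le N$. For $k\ge1$, $\mathcal{L}_k$ is the unique probability measure on $\mathbb{C}^*$ invariant under multiplication by $k$-th roots of unity and whose image under $z\mapsto z^k$ is the law of a product of $k$ independent variables of law $\mathcal{L}$. For $k,r\ge1$,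 $\mathcal{L}_k^{[r]}$ is the measure on $\mathbb{C}^r$ given by $\mathcal{L}_k^{[r]}=\sum (z_1,\dots,z_r).\mathcal{L}_k$, the sum being over $r$-tuples of pairwise distinct elements $z_1,\dots,z_r$ of the group $\mathbb{U}_k$ of $k$-th roots of unity, where $(z_1,\dots,z_r).\mathcal{L}_k$ is the image of $\mathcal{L}_k$ under $z\mapsto(zz_1,\dots,zz_r)$ (so $\mathcal{L}_k^{[r]}=0$ if $r>k$). The tensor product is a measure on $\mathbb{C}^q$ (factors with $\lambda_{k,r}=0$ being omitted), and for a measure $\nu$ on $\mathbb{C}^q$ and $\sigma\in\Sigma_q$, $\sigma.\nu$ is the image of $\nu$ under the permutation $\sigma$ of the coordinates. *)

(* Defs.v *)
From HB Require Import structures.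
From mathcomp Require Import all_boot all_order all_algebra all_fingroup.
From mathcomp Require Import finmap.
From mathcomp Require Import all_classical all_reals all_analysis measurable_realfun.
From mathcomp Require Import complex.

Set Implicit Arguments.
Unset Strict Implicit.
Unset Printing Implicit Defensive.

Import Order.TTheory GRing.Theory Num.Theory.

Local Open Scope classical_set_scope.
Local Open Scope ring_scope.

(* The Borel sigma-algebra of the complex plane: the one generated by the real
   and imaginary parts. *)
Definition complex_display : measure_display. Proof. exact: default_measure_display. Qed.

Section complex_measurable.
Context {R : realType}.

HB.instance Definition _ := isPointed.Build R[i] 0.

Local Notation reim := (g_sigma_preimageU (@complex.Re R) (@complex.Im R)).

Let reim0 : reim (set0 : set R[i]).
Proof. exact: sigma_algebra0. Qed.

Let reimC A : reim A -> reim (~` A).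
Proof. exact: sigma_algebraC. Qed.

Let reimU (F : _^nat) : (forall i, reim (F i)) -> reim (\bigcup_i (F i)).
Proof. exact: sigma_algebra_bigcup. Qed.

HB.instance Definition _ :=
  @isMeasurable.Build complex_display R[i] reim reim0 reimC reimU.

Lemma measurable_complexP d (T : measurableType d) (f : T -> R[i]) :
  measurable_fun setT f <->
  measurable_fun setT (fun x => complex.Re (f x)) /\
  measurable_fun setT (fun x => complex.Im (f x)).
Proof.
apply: (@iff_trans _ (g_sigma_preimageU
    (fun x => complex.Re (f x)) (fun x => complex.Im (f x)) `<=` measurable)).
- have -> : g_sigma_preimageU (fun x => complex.Re (f x)) (fun x => complex.Im (f x)) =
      preimage_set_system setT f reim by rewrite -g_sigma_preimageU_comp.
  split=> [mf A [C HC <-]|f12]; first exact: mf.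
  by move=> _ A mA; apply: f12; exists A.
- split => [h12|[mf1 mf2]].
    split => _ A mA; apply: h12; apply: sub_sigma_algebra;
    by [left; exists A|right; exists A].
  apply: smallest_sub; first exact: sigma_algebra_measurable.
  by rewrite subUset; split=> [|] A [C mC <-]; [exact: mf1|exact: mf2].
Qed.

Lemma measurable_complexM d (T : measurableType d) (f g : T -> R[i]) :
  measurable_fun setT f -> measurable_fun setT g ->
  measurable_fun setT (fun x => f x * g x).
Proof.
move=> /measurable_complexP[f1 f2] /measurable_complexP[g1 g2].
apply/measurable_complexP; split.
- rewrite (_ : (fun _ => _) =
    (fun x => complex.Re (f x) * complex.Re (g x) - complex.Im (f x) * complex.Im (g x))); last first.
    by apply/funext => x; case: (f x) => ? ?; case: (g x).
  by apply: measurable_funB; exact: measurable_funM.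
- rewrite (_ : (fun _ => _) =
    (fun x => complex.Re (f x) * complex.Im (g x) + complex.Im (f x) * complex.Re (g x))); last first.
    by apply/funext => x; case: (f x) => ? ?; case: (g x).
  by apply: measurable_funD; exact: measurable_funM.
Qed.

End complex_measurable.

(* Matrices carry the product sigma-algebra of their entries. *)
Definition matrix_display : measure_display -> measure_display.
Proof. exact. Qed.

Section matrix_measurable.
Context {d} {T : measurableType d} {m n : nat}.

Definition entry_preimages : set (set 'M[T]_(m, n)) :=
  [set A | exists i j (B : set T), measurable B /\
                                   A = (fun M : 'M[T]_(m, n) => M i j) @^-1` B].

Local Notation entries := (<<s entry_preimages >>).

Let entries0 : entries (set0 : set 'M[T]_(m, n)).
Proof. exact: sigma_algebra0. Qed.

Let entriesC A : entries A -> entries (~` A).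
Proof. by rewrite -setTD; exact: sigma_algebraCD. Qed.

Let entriesU (F : _^nat) :
  (forall i, entries (F i)) -> entries (\bigcup_i (F i)).
Proof. exact: sigma_algebra_bigcup. Qed.

HB.instance Definition _ := @isMeasurable.Build (matrix_display d)
  'M[T]_(m, n) entries entries0 entriesC entriesU.

Lemma measurable_matrixP d' (U : measurableType d') (f : U -> 'M[T]_(m, n)) :
  (forall i j, measurable_fun setT (fun x => f x i j)) ->
  measurable_fun setT f.
Proof.
move=> mf; apply: (measurability entry_preimages) => // _ [_ [i [j [B [mB ->]]]] <-].
exact: mf.
Qed.

End matrix_measurable.

(* Permutations carry the discrete sigma-algebra. *)
Section perm_measurable.
Context {T : finType}.

HB.instance Definition _ := isPointed.Build (perm_type T) 1%g.

HB.instance Definition _ := @isMeasurable.Build default_measure_display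
  (perm_type T) discrete_measurable discrete_measurable0
  discrete_measurableC discrete_measurableU.

End perm_measurable.

Section finite_sums_of_measures.
Local Open Scope ereal_scope.
Context {d} {T : measurableType d} {R : realType} {I : finType}.
Variable P : pred I.

Definition mfsum (m : I -> set T -> \bar R) (A : set T) : \bar R :=
  \sum_(i | P i) m i A.

Section measure.
Variable m : I -> {measure set T -> \bar R}.

Let mfsum0 : mfsum m set0 = 0.
Proof. by rewrite /mfsum big1. Qed.

Let mfsum_ge0 B : 0 <= mfsum m B.
Proof. by rewrite /mfsum; apply: sume_ge0. Qed.

Let mfsum_sigma_additive : semi_sigma_additive (mfsum m).
Proof.
move=> F mF tF mUF; rewrite [X in _ --> X](_ : _ =
    lim ((fun n => \sum_(0 <= i < n) mfsum m (F i)) @ \oo)).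
  by apply: is_cvg_ereal_nneg_natsum => k _; exact: sume_ge0.
rewrite nneseries_sum//; apply: eq_bigr => /= i _.
exact: measure_semi_bigcup.
Qed.

HB.instance Definition _ := isMeasure.Build _ _ _ (mfsum m)
  mfsum0 mfsum_ge0 mfsum_sigma_additive.
End measure.

Section finite_measure.
Variable m : I -> {finite_measure set T -> \bar R}.

Let mfsum_fin : fin_num_fun (mfsum m).
Proof.
move=> A mA; rewrite /mfsum; apply/sum_fin_numP => i _ _.
exact: fin_num_measure.
Qed.

HB.instance Definition _ := Measure_isFinite.Build _ _ _ (mfsum m) mfsum_fin.
End finite_measure.

End finite_sums_of_measures.

Section image_measures.
Context {d1 d2} {T1 : measurableType d1} {T2 : measurableType d2} {R : realType}.
Variables (f : {mfun T1 >-> T2}) (m : {finite_measure set T1 -> \bar R}).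

Definition image_measure : set T2 -> \bar R := pushforward m f.

Let image0 : image_measure set0 = 0%E.
Proof. exact: measure0. Qed.

Let image_ge0 A : (0 <= image_measure A)%E.
Proof. exact: measure_ge0. Qed.

Let image_sigma_additive : semi_sigma_additive image_measure.
Proof. exact: measure_semi_sigma_additive. Qed.

HB.instance Definition _ := isMeasure.Build _ _ _ image_measure
  image0 image_ge0 image_sigma_additive.

Let image_fin : fin_num_fun image_measure.
Proof.
move=> A mA; apply: fin_num_measure.
by rewrite -[X in measurable X]setTI; exact: measurable_funPT.
Qed.

HB.instance Definition _ := Measure_isFinite.Build _ _ _ image_measure image_fin.

End image_measures.

Section finite_products.
Local Open Scope ereal_scope.
Context {d1 d2} {T1 : measurableType d1} {T2 : measurableType d2} {R : realType}.
Variables (m1 : {finite_measure set T1 -> \bar R})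
          (m2 : {finite_measure set T2 -> \bar R}).

Definition finite_product : set (T1 * T2) -> \bar R := m1 \x m2.

HB.instance Definition _ := Measure.on finite_product.

Let finite_product_fin : fin_num_fun finite_product.
Proof.
move=> A mA; rewrite ge0_fin_numE//.
apply: (@le_lt_trans _ _ (finite_product setT)).
  by apply: le_measure => //; rewrite inE.
rewrite /finite_product -setXTT product_measure1E//.
apply: lte_mul_pinfty => //; first exact: fin_num_measure.
by rewrite -ge0_fin_numE//; exact: fin_num_measure.
Qed.

HB.instance Definition _ := Measure_isFinite.Build _ _ _
  finite_product finite_product_fin.

End finite_products.

Section iid.
Context {d} {T : measurableType d} {R : realType}.

Definition tcons n (z : T * n.-tuple T) : n.+1.-tuple T := [tuple of z.1 :: z.2].

Let measurable_tcons n : measurable_fun setT (@tcons n).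
Proof. exact: measurable_cons. Qed.

HB.instance Definition _ n :=
  isMeasurableFun.Build _ _ _ _ (@tcons n) (@measurable_tcons n).

Fixpoint iid (P : probability T R) n : probability (n.-tuple T) R :=
  if n is n'.+1 then distribution (P \x iid P n')%E (@tcons n')
  else \d_([tuple] : 0.-tuple T).

End iid.

Section random_matrix.
Context {R : realType} {N : nat}.

(* The number of cycles of s, fixed points included, is #|porbits s|. The
   second argument of mnormalize is only used when the total mass is 0 or
   infinite, which does not happen here. *)
Definition ewens (theta : {posnum R}) : probability 'S_N R :=
  mnormalize
    (mfsum xpredT (fun s : 'S_N => mscale (theta%:num ^+ #|porbits s|)%:nng \d_s))
    \d_(1%g : 'S_N).

Definition perm_matrix (sz : 'S_N * N.-tuple R[i]) : 'M[R[i]]_N :=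
  \matrix_(j, k) (tnth sz.2 j * (j == sz.1 k)%:R).

Let measurable_perm_matrix : measurable_fun setT perm_matrix.
Proof.
apply: measurable_matrixP => j k; under eq_fun do rewrite mxE.
apply: measurable_complexM.
  exact: (measurableT_comp (measurable_tnth j) measurable_snd).
pose h (s : 'S_N) : R[i] := (j == s k)%:R.
suff mh : measurable_fun setT h by exact: (measurableT_comp mh measurable_fst).
by [].
Qed.

HB.instance Definition _ :=
  isMeasurableFun.Build _ _ _ _ perm_matrix measurable_perm_matrix.

Definition matrix_law (theta : {posnum R}) (L : probability R[i] R) :
    probability 'M[R[i]]_N R :=
  distribution (ewens theta \x iid L N)%E perm_matrix.

End random_matrix.
Arguments matrix_law {R} N theta L.

(* The roots listed with multiplicity, in an unspecified order. *)
Definition croots {R : realType} (p : {poly R[i]}) : seq R[i] :=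
  sval (closed_field_poly_normal p).

Lemma crootsE {R : realType} (p : {poly R[i]}) :
  p = lead_coef p *: \prod_(z <- croots p) ('X - z%:P).
Proof. exact: svalP (closed_field_poly_normal p). Qed.

Section correlation.
Context {R : realType} {N : nat}.

Definition eigenvalues (M : 'M[R[i]]_N) : seq R[i] := croots (char_poly M).

Lemma size_eigenvalues M : size (eigenvalues M) = N.
Proof.
have := congr1 (fun p : {poly R[i]} => size p) (crootsE (char_poly M)).
rewrite size_char_poly (monicP (char_poly_monic M)) scale1r.
by rewrite size_prod_XsubC => -[].
Qed.

Definition point_correlation (q : nat) (M : 'M[R[i]]_N) :
    {finite_measure set (q.-tuple R[i]) -> \bar R} :=
  mfsum (fun j : q.-tuple 'I_N => uniq j)
    (fun j => \d_[tuple of [seq (eigenvalues M)`_i | i : 'I_N <- j]]).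

Definition correlation_measure (q : nat) (theta : {posnum R})
    (L : probability R[i] R) (A : set (q.-tuple R[i])) : \bar R :=
  (\int[matrix_law N theta L]_M point_correlation q M A)%E.

End correlation.
Arguments correlation_measure {R} N q theta L A.

Section cycle_laws.
Context {R : realType}.
Variable L : probability R[i] R.

(* A measure on the nonzero complex numbers is encoded as a measure on R[i]
   that does not charge 0. *)
Definition is_root_law (k : nat) (P : probability R[i] R) : Prop :=
  [/\ P [set 0] = 0%E,
      forall u : R[i], u ^+ k = 1 -> forall A, measurable A ->
        pushforward P (fun z => u * z) A = P A &
      forall A, measurable A ->
        pushforward P (fun z : R[i] => z ^+ k) A =
        pushforward (iid L k) (fun z => \prod_(i < k) tnth z i) A].

(* For k >= 1 and L not charging 0, exactly one probability satisfies
   is_root_law k, so the default value of get is never reached. *)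
Definition root_law (k : nat) : probability R[i] R := get (is_root_law k).

(* For k >= 1 this lists the k-th roots of unity without repetition. *)
Definition unity_roots (k : nat) : seq R[i] := croots ('X^k - 1).

Lemma mem_unity_roots k z : (0 < k)%N -> (z \in unity_roots k) = (z ^+ k == 1).
Proof.
move=> k0; have := crootsE ('X^k - 1 : {poly R[i]}).
rewrite lead_coefDl ?lead_coefXn ?scale1r; last first.
  by rewrite size_polyN size_polyXn size_poly1.
rewrite -/(unity_roots k) => E.
by rewrite -root_prod_XsubC -E /root !hornerE subr_eq0.
Qed.

Definition multiples r (u : r.-tuple R[i]) (z : R[i]) : r.-tuple R[i] :=
  [tuple z * tnth u i | i < r].

Let measurable_multiples r u : measurable_fun setT (@multiples r u).
Proof.
apply/measurable_fun_tnthP => i.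
rewrite [X in measurable_fun _ X](_ : _ = fun z : R[i] => z * tnth u i).
  by apply: measurable_complexM => //; exact: measurable_cst.
by apply/funext => z /=; rewrite tnth_mktuple.
Qed.

HB.instance Definition _ r u :=
  isMeasurableFun.Build _ _ _ _ (@multiples r u) (@measurable_multiples r u).

Definition root_correlation (k r : nat) :
    {finite_measure set (r.-tuple R[i]) -> \bar R} :=
  mfsum (fun u : r.-tuple (seq_sub (unity_roots k)) => uniq u)
    (fun u => image_measure (multiples [tuple of map val u]) (root_law k)).

Definition tcat m n (z : m.-tuple R[i] * n.-tuple R[i]) : (m + n).-tuple R[i] :=
  [tuple of z.1 ++ z.2].

Let measurable_tcat m n : measurable_fun setT (@tcat m n).
Proof.
apply/measurable_fun_tnthP => i; rewrite -(splitK i).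
case: (fintype.split i) => k /=.
  rewrite [X in measurable_fun _ X](_ : _ = (@tnth _ R[i] ^~ k) \o fst).
    exact: (measurableT_comp (measurable_tnth k) measurable_fst).
  by apply/funext => z /=; rewrite tnth_lshift.
rewrite [X in measurable_fun _ X](_ : _ = (@tnth _ R[i] ^~ k) \o snd).
  exact: (measurableT_comp (measurable_tnth k) measurable_snd).
by apply/funext => z /=; rewrite tnth_rshift.
Qed.

HB.instance Definition _ m n :=
  isMeasurableFun.Build _ _ _ _ (@tcat m n) (@measurable_tcat m n).

Fixpoint tensor (s : seq (nat * nat)) :
    {finite_measure set ((sumn (unzip2 s)).-tuple R[i]) -> \bar R} :=
  if s is (k, r) :: s' then
    image_measure (@tcat r (sumn (unzip2 s')))
      (finite_product (root_correlation k r) (tensor s'))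
  else \d_([tuple] : 0.-tuple R[i]).

End cycle_laws.

(* Here m and q are meant to be equal, see sumn_blocks below: m is the
   expression sumn (unzip2 _), which is not convertible to q. *)
Definition permute {R : realType} {m q : nat} (s : 'S_q) (z : m.-tuple R[i]) :
    q.-tuple R[i] :=
  [tuple z`_(s i) | i < q].

Local Notation family := {fsfun nat * nat -> nat with 0%N}.

(* A family indexed by the pairs (k, r) with k, r >= 1 is a finitely supported
   function on nat * nat whose support avoids k = 0 and r = 0; the constraint
   on the sum of the r * l (k, r) makes every support finite. *)
Definition weight (l : family) : nat := (\sum_(kr <- finsupp l) kr.1 * l kr)%N.

Definition Ltilde (N q : nat) : set family :=
  [set l : family |
    [/\ forall kr, kr \in finsupp l -> (0 < kr.1)%N && (0 < kr.2)%N,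
        (\sum_(kr <- finsupp l) kr.2 * l kr = q)%N &
        (weight l <= N)%N]].

(* Each pair (k, r) is repeated l (k, r) times. *)
Definition blocks (l : family) : seq (nat * nat) :=
  flatten [seq nseq (l kr) kr | kr <- finsupp l].

Lemma sumn_blocks (N q : nat) (l : family) :
  Ltilde N q l -> sumn (unzip2 (blocks l)) = q.
Proof.
case=> _ <- _; rewrite /blocks /unzip2; elim: (enum_fset (finsupp l)) => [|kr s IHs] /=.
  by rewrite big_nil.
by rewrite big_cons map_cat sumn_cat map_nseq sumn_nseq IHs.
Qed.

Lemma Ltilde_bound (N q : nat) (l : family) k r : Ltilde N q l ->
  l (k, r) != 0%N -> [/\ (0 < k)%N, (0 < r)%N, (k <= N)%N, (r <= q)%N &
    (l (k, r) <= q)%N].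
Proof.
move=> [pos rq kN] l0.
have kr : (k, r) \in finsupp l by rewrite mem_finsupp.
have /andP[/= k0 r0] := pos _ kr.
have term (F : nat * nat -> nat) :
    (F (k, r) <= \sum_(kr <- finsupp l) F kr)%N.
  by rewrite (bigD1_seq (k, r) kr (fset_uniq _))/= leq_addr.
have /= := term (fun kr => kr.2 * l kr)%N; rewrite rq => rlq.
have /= klN := leq_trans (term (fun kr => kr.1 * l kr)%N) kN.
have l1 : (0 < l (k, r))%N by rewrite lt0n.
split => //.
- exact: leq_trans (leq_pmulr _ l1) klN.
- exact: leq_trans (leq_pmulr _ l1) rlq.
- exact: leq_trans (leq_pmull _ r0) rlq.
Qed.

Lemma finite_Ltilde (N q : nat) : finite_set (Ltilde N q).
Proof.
pose f (l : family) :=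
  [ffun p : 'I_N.+1 * 'I_q.+1 => inord (l (val p.1, val p.2)) : 'I_q.+1].
have finj : {in Ltilde N q &, injective f}.
  move=> l1 l2; rewrite !inE => L1 L2 /ffunP f12; apply/fsfunP => -[k r].
  have [/andP[kN rq]|] := boolP ((k <= N) && (r <= q))%N; last first.
    have out l : Ltilde N q l -> ~~ ((k <= N) && (r <= q))%N -> l (k, r) = 0%N.
      move=> Ll; apply: contraNeq => /(Ltilde_bound Ll)[_ _ kN rq _].
      by rewrite kN rq.
    by move=> nkr; rewrite !out.
  have le l : Ltilde N q l -> (l (k, r) < q.+1)%N.
    move=> Ll; have [->//|/(Ltilde_bound Ll)[]//] := eqVneq (l (k, r)) 0%N.
  have := f12 (Ordinal (kN : k < N.+1)%N, Ordinal (rq : r < q.+1)%N).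
  by rewrite !ffunE /= => /(congr1 (@nat_of_ord _)); rewrite !inordK ?le.
rewrite -(eq_finite_set (inj_card_eq finj)); exact: finite_finset.
Qed.

(* Main.v *)
Require Import Defs.
From HB Require Import structures.
From mathcomp Require Import all_boot all_order all_algebra all_fingroup.
From mathcomp Require separable cyclotomic.
From mathcomp Require Import finmap.
From mathcomp Require Import all_classical all_reals all_analysis.
From mathcomp Require Import measurable_realfun.
From mathcomp Require Import complex ring lra.

(** Both sides add up the same contributions: those of the ways in which a
    tuple of q distinct eigenvalues meets the cycles of the permutation.

    Let s and z be fixed. The characteristic polynomial of the matrix is the
    product over the cycles C of s of X^#|C| - z_C, where z_C is the product
    of the z_i for i in C [char_poly_perm_matrix]. A cycle of length k thus
    carries the k eigenvalues rho u, where rho is a k-th root of z_C and u runs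
    through the k-th roots of unity. A set of q eigenvalue indices has a type
    l, where l (k, r) is the number of cycles of length k that contain exactly
    r of its elements, and the types that occur belong to Ltilde N q. To list
    the sets of type l, choose distinct cycles C_1, ..., C_p with the lengths
    k_b prescribed by blocks l, then an ordered tuple of r_b distinct
    eigenvalues in each C_b. Each set is reached exactly
    \prod l (k, r)! r!^(l (k, r)) times [sum_over_types], which explains the
    factorials of the formula; the sum over the permutations of the coordinates
    appears because the indicator of A is symmetrised first.

    Next, integrate over z. Disjoint cycles have independent products z_C, and
    the sum over the tuples of distinct roots of unity does not depend on the
    choice of the root rho of z_C, so that its expectation is an integral
    against root_correlation L k r [integral_root_correlation].
    For a given choice of cycles the expectation is therefore the integral
    against tensor L (blocks l), whatever the cycles
    [integral_nested_selection].

    It remains to compute the expected number of tuples of distinct cycles with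
    lengths k_1, ..., k_p under the Ewens measure. Cutting the cycles out of
    the permutation one at a time [sum_perm_cut_cycle], this number is the
    falling factorial of N with K = k_1 + ... + k_p factors, times
    \prod (theta / k_b), times a quotient of total weights of permutations of
    N - K and of N points [sum_perm_on_count_blocks, rising_ratio].

    On the analytic side, the eigenvalues come in an unspecified order, and
    the correlation functional is shown to be measurable only on the matrices
    supported on a permutation, which is enough to integrate it
    [integral_pushforward_on]. An explicit measurable k-th root on the complex
    plane describes the eigenvalues there, and also provides the law L_k. *)

Set Implicit Arguments.
Unset Strict Implicit.
Unset Printing Implicit Defensive.

Import Order.TTheory GRing.Theory Num.Theory.

Local Open Scope ring_scope.

(** * Cycles of a permutation weighted by their number *)

Section CycleCounting.
Variable T : finType.
Implicit Types (s : {perm T}) (D C : {set T}) (y : seq T).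

(** Cycles are counted relative to D because a permutation of D fixes all the
    other points, and these fixed points must not contribute to the weight when
    the cycles are cut out one at a time. *)
Definition cycles_on s D : {set {set T}} := [set porbit s x | x in D].

Lemma cycles_onT s : cycles_on s [set: T] = porbits s.
Proof.
by apply/setP => C; apply/imsetP/imsetP => -[x _ ->]; exists x; rewrite ?inE.
Qed.

Lemma porbit_closed s D x : perm_on D s -> x \in D -> porbit s x \subset D.
Proof.
move=> sD xD; apply/fintype.subsetP => z /porbitP[i ->].
by elim: i => [|i IHi]; rewrite ?expg0 ?perm1// expgSr permM perm_closed.
Qed.

Lemma card_porbit_gt0 s x : (0 < #|porbit s x|)%N.
Proof. by rewrite lt0n card_porbit_neq0. Qed.

Lemma cycles_on_setU1 s D x : perm_on D s -> x \in D ->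
  cycles_on s D = porbit s x |: cycles_on s (D :\: porbit s x).
Proof.
move=> sD xD; apply/setP => C; rewrite in_setU1; apply/imsetP/orP.
  move=> [z zD ->]; have [zx|zx] := boolP (z \in porbit s x).
    by left; rewrite eq_porbit_mem.
  by right; apply/imsetP; exists z; rewrite // inE zx.
move=> [/eqP ->|/imsetP[z]]; first by exists x.
by rewrite inE => /andP[_ zD] ->; exists z.
Qed.

Lemma porbit_notin_cycles_on s D x : porbit s x \notin cycles_on s (D :\: porbit s x).
Proof.
apply/imsetP => -[z]; rewrite inE => /andP[zx _] /eqP.
by rewrite eq_porbit_mem porbit_sym (negbTE zx).
Qed.

Definition seq_cycle y (Uy : uniq y) : {perm T} := perm (can_inj (prev_next Uy)).

Lemma seq_cycle_on y (Uy : uniq y) : perm_on [set z in y] (seq_cycle Uy).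
Proof.
apply/fintype.subsetP => z; rewrite !inE permE; apply: contraNT => zy.
by rewrite next_nth (negbTE zy).
Qed.

(** Left multiplication by the cycle along y matches the permutations of the
    complement of y in D with the permutations of D that run along y. *)
Lemma fcycle_perm_on y (Uy : uniq y) D s : {subset y <= D} ->
  perm_on D (seq_cycle Uy * s)%g && fcycle (seq_cycle Uy * s)%g y =
  perm_on (D :\: [set z in y]) s.
Proof.
move=> yD; apply/andP/idP => [[on cy]|on].
  apply/fintype.subsetP => z; rewrite !inE => sz.
  have zy : z \notin y.
    apply: contraNN sz => zy; have py : prev y z \in y by rewrite mem_prev.
    have /eqP := next_cycle cy py.
    by rewrite /= permM permE (next_prev Uy) => ->.
  rewrite zy /=; apply: contraNT sz => zD; apply/eqP.
  have := out_perm on zD; rewrite permM (out_perm (seq_cycle_on Uy))//.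
  by rewrite inE.
have fixy z : z \in y -> s z = z.
  by move=> zy; apply: (out_perm on); rewrite !inE zy.
split.
  apply: perm_onM.
    apply: fintype.subset_trans (seq_cycle_on Uy) _; apply/fintype.subsetP => z.
    by rewrite inE => /yD.
  by apply: fintype.subset_trans on _; apply/fintype.subsetP => z /finset.setDP[].
apply: (cycle_from_next Uy) => z zy /=.
by rewrite permM permE fixy ?mem_next.
Qed.

Lemma cycles_on_seq_cycle y (Uy : uniq y) D s :
  perm_on (D :\: [set z in y]) s ->
  cycles_on (seq_cycle Uy * s)%g (D :\: [set z in y]) = cycles_on s (D :\: [set z in y]).
Proof.
move=> on; apply: eq_in_imset => x xD; apply/setP => z.
have E i : ((seq_cycle Uy * s) ^+ i)%g x = (s ^+ i)%g x /\
    (s ^+ i)%g x \in D :\: [set z in y].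
  elim: i => [|i [IH1 IH2]]; first by rewrite !expg0 perm1.
  rewrite !expgSr !permM IH1 perm_closed//; split=> //.
  rewrite (out_perm (seq_cycle_on Uy))//.
  by case/finset.setDP: IH2.
by apply/porbitP/porbitP => -[i ->]; exists i; rewrite (E i).1.
Qed.

Lemma porbit_fcycle s x p : uniq (x :: p) -> fcycle s (x :: p) ->
  porbit s x = [set z in x :: p] /\ x :: p = traject s x (size p).+1.
Proof.
move=> U cy.
have E : x :: p = traject s x (size p).+1.
  have := fpathE cy; rewrite size_rcons trajectSr /= => /rcons_inj[].
  by move=> -> _; rewrite size_traject.
split=> //; apply/setP => z; rewrite inE; apply/porbitP/idP => [[i ->]|].
  elim: i => [|i IHi]; first by rewrite expg0 perm1 mem_head.
  by rewrite expgSr permM (mem_fcycle cy).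
by rewrite E => /trajectP[i _ ->]; exists i; rewrite permX.
Qed.

Lemma fcycle_traject s x k : #|porbit s x| = k.+1 ->
  fcycle s (traject s x k.+1).
Proof.
move=> xk; rewrite /= rcons_path fpath_traject /= last_traject.
by rewrite -iterS -xk iter_porbit.
Qed.

(** Once the cycle is rooted at x it is a word without repetition, read
    off by iterating s; what remains is an arbitrary permutation of the
    other points. *)
Lemma sum_perm_cut_cycle (V : nmodType) D x k
    (G : {set {set T}} -> {set T} -> V) : x \in D ->
  \sum_(s | perm_on D s && (#|porbit s x| == k.+1))
     G (cycles_on s (D :\: porbit s x)) (porbit s x) =
  \sum_(y : k.-tuple T | uniq (x :: y) && all [in D] (x :: y))
     \sum_(s | perm_on (D :\: [set z in x :: y]) s)
       G (cycles_on s (D :\: [set z in x :: y])) [set z in x :: y].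
Proof.
move=> xD.
pose p s : k.-tuple T := Tuple (introT eqP (size_traject s (s x) k)).
rewrite (partition_big p (fun y : k.-tuple T => uniq (x :: y) && all [in D] (x :: y))).
  apply: eq_bigr => y /andP[Uy yD].
  have yD' : {subset x :: y <= D} by apply/allP.
  rewrite [RHS](eq_bigl (fun s => perm_on D (seq_cycle Uy * s)%g &&
     fcycle (seq_cycle Uy * s)%g (x :: y))); last first.
    by move=> s; rewrite fcycle_perm_on.
  rewrite (reindex_inj (mulgI (seq_cycle Uy))).
  apply: eq_big => [s|s].
    rewrite -andbA; congr (_ && _); apply/andP/idP => [[/eqP xk /eqP py]|cy].
      by move: xk py; move: (_ * s)%g => s1 xk <-; exact: fcycle_traject.
    have [-> Ey] := porbit_fcycle Uy cy.
    have -> : #|[set z in x :: y]| = k.+1.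
      by rewrite cardsE (card_uniqP Uy) /= size_tuple.
    split=> //; apply/eqP/val_inj => /=.
    by move: Ey; rewrite size_tuple /= => -[].
  rewrite -andbA => /and3P[on /eqP xk /eqP py].
  have cy : fcycle (seq_cycle Uy * s)%g (x :: y).
    by move: xk py; move: (_ * s)%g => s1 xk <-; exact: fcycle_traject.
  have [-> _] := porbit_fcycle Uy cy.
  by rewrite cycles_on_seq_cycle// -fcycle_perm_on// on.
move=> s /andP[on /eqP xk].
have -> : x :: p s = traject s x #|porbit s x| by rewrite xk.
rewrite uniq_traject_porbit; apply/allP => z; rewrite -porbit_traject.
by apply/fintype.subsetP; exact: porbit_closed.
Qed.

End CycleCounting.

Section EwensMoments.
Variables (K : numFieldType) (theta : K).

Definition rising n : K := \prod_(i < n) (theta + i%:R).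

Lemma risingS n : rising n.+1 = rising n * (theta + n%:R).
Proof. by rewrite /rising big_ord_recr. Qed.

(** The recursion obeyed by the total weight of the permutations of n + 1
    points, when they are classified by the length k + 1 of the cycle through a
    given point. *)
Lemma sum_ffact_rising n :
  \sum_(k < n.+1) (n ^_ k)%:R * (theta * rising (n - k)) = rising n.+1.
Proof.
elim: n => [|n IHn].
  by rewrite big_ord1 risingS /rising big_ord0 !(mulr1, mul1r, addr0).
rewrite big_ord_recl ffactn0 subn0 mul1r.
under eq_bigr => i _.
  rewrite lift0 ffactSS subSS natrM -mulrA; over.
by rewrite -mulr_sumr IHn [RHS]risingS mulrDr [X in X + _]mulrC [X in _ + X]mulrC.
Qed.

Variable T : finType.
Implicit Types (s : {perm T}) (D C : {set T}) (Z : {set {set T}}).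

(** Nested, with the chosen block removed from Z at each step, to run in
    parallel with the expansions of the correlation measure below. *)
Fixpoint count_blocks (ks : seq nat) Z : K :=
  if ks is k :: ks' then \sum_(C in Z | #|C| == k) count_blocks ks' (Z :\ C)
  else 1.

Lemma card_uniq_words D x k : x \in D ->
  #|[pred y : k.-tuple T | uniq (x :: y) && all [in D] (x :: y)]| =
  #|D|.-1 ^_ k.
Proof.
move=> xD; rewrite (cardsD1 x D) xD /=.
have -> : #|D :\ x| = #|[pred z | z \in D :\ x]| by apply: eq_card.
rewrite -card_uniq_tuples cardsE; apply: eq_card => y.
rewrite !inE /= xD /= unfold_in /=.
have -> : all (fun z => z \in D :\ x) y = (x \notin tval y) && all [in D] y.
  elim: (tval y) => // z y' /= ->; rewrite !inE negb_or eq_sym.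
  by rewrite -!andbA; congr (_ && _); rewrite andbCA.
by rewrite andbAC.
Qed.

(** By induction on D, cutting out the cycle of some point. *)
Lemma sum_perm_on_rising D :
  \sum_(s | perm_on D s) theta ^+ #|cycles_on s D| = rising #|D|.
Proof.
have [n le_Dn] := ubnP #|D|; elim: n => // n IHn in D le_Dn *.
have [->|[x xD]] := set_0Vmem D.
  rewrite cards0 /rising big_ord0 (big_pred1 1%g) ?/cycles_on ?imset0 ?cards0// => s.
  apply/idP/eqP => [on|->]; last exact: perm_on1.
  by apply/permP => x; rewrite perm1 (out_perm on)// inE.
have D0 : (0 < #|D|)%N by apply/card_gt0P; exists x.
have lt_porbit s : perm_on D s -> (#|porbit s x|.-1 < #|D|)%N.
  move=> on; apply: leq_trans (subset_leq_card (porbit_closed on xD)).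
  by rewrite prednK// card_porbit_gt0.
pose p s := inord #|porbit s x|.-1 : 'I_(#|D|.-1.+1).
rewrite (partition_big p predT)//= -[in RHS](prednK D0) -sum_ffact_rising.
apply: eq_bigr => k _.
rewrite (eq_bigl (fun s => perm_on D s && (#|porbit s x| == k.+1))); last first.
  move=> s; case on: (perm_on D s) => //=.
  rewrite -val_eqE /= inordK; last by rewrite (prednK D0) lt_porbit.
  by rewrite -eqSS prednK// card_porbit_gt0.
rewrite (eq_bigr (fun s => theta ^+ (#|cycles_on s (D :\: porbit s x)|).+1)); last first.
  move=> s /andP[on _]; rewrite (cycles_on_setU1 on xD) cardsU1.
  by rewrite porbit_notin_cycles_on.
rewrite (@sum_perm_cut_cycle _ K D x _ (fun Z _ => theta ^+ #|Z|.+1) xD).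
rewrite (eq_bigr (fun=> theta * rising (#|D|.-1 - k))).
  by rewrite sumr_const card_uniq_words// mulr_natl.
move=> y /andP[Uy yD].
under eq_bigr do rewrite exprS.
rewrite -mulr_sumr; congr (_ * _).
have Dy : #|D :\: [set z in x :: y]| = (#|D|.-1 - k)%N.
  rewrite cardsD (finset.setIidPr _); last first.
    by apply/fintype.subsetP => z; rewrite inE; apply/allP.
  by rewrite cardsE (card_uniqP Uy) /= size_tuple -{1}(prednK D0) subSS.
rewrite IHn Dy//; apply: leq_ltn_trans (leq_subr _ _) _.
by rewrite -ltnS prednK.
Qed.

Lemma ffactD m n p : (m ^_ (n + p) = m ^_ n * (m - n) ^_ p)%N.
Proof.
elim: p => [|p IHp]; first by rewrite addn0 ffactn0 muln1.
by rewrite addnS !ffactnSr IHp mulnA subnDA.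
Qed.

(** Each chosen cycle of length k has weight theta and k possible roots, whence
    the factors of the product; the words that trace the rooted cycles are
    counted by the falling factorial, and the last factor is the weight of the
    permutations of the points that are left. *)
Lemma sum_perm_on_count_blocks (ks : seq nat) D : all (leq 1) ks ->
  \sum_(s | perm_on D s) theta ^+ #|cycles_on s D| * count_blocks ks (cycles_on s D) =
  (#|D| ^_ (sumn ks))%:R * (\prod_(k <- ks) (theta / k%:R)) *
    rising (#|D| - sumn ks).
Proof.
elim: ks D => [|k ks IHks] D /=.
  move=> _; under eq_bigr do rewrite mulr1.
  by rewrite big_nil !mul1r subn0 sum_perm_on_rising.
case: k => // k /IHks {}IHks.
(* every point of the chosen cycle can serve as its root *)
have root s : perm_on D s -> theta ^+ #|cycles_on s D| *
    (\sum_(C in cycles_on s D | #|C| == k.+1) count_blocks ks (cycles_on s D :\ C)) =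
    k.+1%:R^-1 * \sum_(x in D | #|porbit s x| == k.+1)
      theta ^+ #|cycles_on s (D :\: porbit s x)|.+1 *
      count_blocks ks (cycles_on s (D :\: porbit s x)).
  move=> on; rewrite mulr_sumr.
  rewrite (partition_big (porbit s) (fun C => (C \in cycles_on s D) && (#|C| == k.+1))); last first.
    by move=> x /andP[xD ->]; rewrite imset_f.
  rewrite mulr_sumr; apply: eq_bigr => C /andP[/imsetP[x xD ->] xk].
  rewrite (eq_bigr (fun=> theta ^+ #|cycles_on s D| *
      count_blocks ks (cycles_on s D :\ porbit s x))); last first.
    move=> z /andP[/andP[zD zk] /eqP <-].
    rewrite (cycles_on_setU1 on zD) cardsU1 porbit_notin_cycles_on.
    by rewrite setU1K ?porbit_notin_cycles_on.
  rewrite (eq_bigl (mem (porbit s x))); last first.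
    move=> z /=; rewrite eq_porbit_mem; apply/andP/idP => [[]//|zx]; split=> //.
    rewrite (fintype.subsetP (porbit_closed on xD) _ zx) /=.
    by move: zx; rewrite -eq_porbit_mem => /eqP ->.
  by rewrite sumr_const (eqP xk) -[X in _ = _ * X]mulr_natl mulKf// pnatr_eq0.
rewrite (eq_bigr _ root) -mulr_sumr (exchange_big_dep [in D])/=; last first.
  by move=> s x _ /andP[].
rewrite (eq_bigr (fun=> (#|D|.-1 ^_ k)%:R * (theta *
   (((#|D| - k.+1) ^_ (sumn ks))%:R * (\prod_(k <- ks) (theta / k%:R)) *
    rising (#|D| - (k.+1 + sumn ks)))))); last first.
  move=> x xD.
  rewrite (eq_bigl (fun s => perm_on D s && (#|porbit s x| == k.+1))); last first.
    by move=> s; rewrite xD.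
  rewrite (@sum_perm_cut_cycle _ K D x _ (fun Z _ => theta ^+ #|Z|.+1 * count_blocks ks Z) xD).
  rewrite [LHS](eq_bigr (fun=> theta *
   (((#|D| - k.+1) ^_ (sumn ks))%:R * (\prod_(k <- ks) (theta / k%:R)) *
    rising (#|D| - (k.+1 + sumn ks))))).
    by rewrite sumr_const card_uniq_words// -[LHS]mulr_natl.
  move=> y /andP[Uy yD].
  under [LHS]eq_bigr do rewrite exprS -mulrA.
  have Dy : #|D :\: [set z in x :: y]| = (#|D| - k.+1)%N.
    rewrite cardsD (finset.setIidPr _); last first.
      by apply/fintype.subsetP => z; rewrite inE; apply/allP.
    by rewrite cardsE (card_uniqP Uy) /= size_tuple.
  by rewrite -mulr_sumr IHks Dy subnDA.
rewrite sumr_const -[X in _ * X]mulr_natl ffactD ffactnS !natrM big_cons.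
move: (k.+1%:R^-1) => w; ring.
Qed.

Lemma count_blocks_ge0 ks Z : 0 <= count_blocks ks Z.
Proof.
by elim: ks Z => [|k ks IHks] Z //=; apply: sumr_ge0 => C _; exact: IHks.
Qed.

End EwensMoments.

(** * The characteristic polynomial of a weighted permutation matrix *)

Section CyclePolynomial.
Variables (K : comNzRingType) (n : nat) (s : 'S_n).
Implicit Types (x : K) (z : 'I_n -> K) (C D : {set 'I_n}).

(** With C the whole set this is x - M. Completing by the identity outside
    a union C of cycles makes the matrices attached to disjoint unions
    multiply. *)
Definition cycle_block x z C : 'M[K]_n :=
  \matrix_(i, j) if i \in C then x *+ (i == j) - z i *+ (i == s j)
                 else (i == j)%:R.

Let expansion x z C (i j : 'I_n) (b : bool) : K :=
  if b then (if i \in C then x else 1) *+ (i == j)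
  else if i \in C then - (z i *+ (i == s j)) else 0.

Let expansion_det x z C (f : {ffun 'I_n -> bool}) : K :=
  \sum_(t : 'S_n) (-1) ^+ t * \prod_i expansion x z C i (t i) (f i).

(** Each row on C is a sum of two multiples of basis vectors, and f selects one
    of them in every row; off C the second one is 0. *)
Let det_expansion x z C :
  \det (cycle_block x z C) = \sum_f expansion_det x z C f.
Proof.
rewrite /determinant exchange_big/=; apply: eq_bigr => t _.
rewrite -mulr_sumr -(bigA_distr_bigA (fun i b => expansion x z C i (t i) b)).
congr (_ * _); apply: eq_bigr => i _; rewrite mxE big_bool /expansion.
by case: ifP => _ //=; rewrite addr0.
Qed.

(** A selection that takes the diagonal entry in row s^-1 i but not in row i
    leaves two rows supported on the same column. *)
Let expansion_det_mixed x z C (f : {ffun 'I_n -> bool}) i :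
  i \in C -> ~~ f i -> f (s^-1 i)%g -> expansion_det x z C f = 0.
Proof.
move=> iC /negbTE fi fsi; apply: big1 => t _.
have [ti|ti] := eqVneq i (s (t i)).
  rewrite (bigD1 (s^-1 i)%g)//= {1}/expansion fsi.
  have [tsi|_] := eqVneq (s^-1 i)%g (t (s^-1 i)%g); last by rewrite mul0r mulr0.
  have : t i = t (s^-1 i)%g by rewrite -tsi [in RHS]ti permK.
  by move=> /perm_inj it; move: fi; rewrite it fsi.
rewrite (bigD1 i)//= {1}/expansion fi iC (negbTE ti).
by rewrite mulr0n oppr0 mul0r mulr0.
Qed.

Let expansion_det_cst x z C :
  expansion_det x z C [ffun=> true] = x ^+ #|C|.
Proof.
rewrite /expansion_det (bigD1 1%g)//= odd_perm1 expr0 mul1r.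
rewrite [X in _ + X]big1 ?addr0 => [|t t1].
  under eq_bigr do rewrite /expansion ffunE perm1 eqxx.
  by rewrite -big_mkcond/= prodr_const.
have [i ti] : exists i, t i != i.
  apply/existsP; apply: contraNT t1 => /existsPn t1; apply/eqP/permP => i.
  by rewrite perm1; apply/eqP; rewrite -[_ == _]negbK.
rewrite (bigD1 i)//= {1}/expansion ffunE eq_sym (negbTE ti).
by rewrite mulr0n mul0r mulr0.
Qed.

(** This is plus or minus the signature of the cycle. Only its independence of
    x and z is used, so that its value can be read off from a particular
    matrix. *)
Let det_sign C : K := \sum_(t : 'S_n) (-1) ^+ t *
  \prod_i (if i \in C then - (i == s (t i))%:R else (i == t i)%:R).

Let expansion_det_cycle x z C :
  expansion_det x z C [ffun i => i \notin C] = det_sign C * \prod_(i in C) z i.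
Proof.
rewrite mulr_suml; apply: eq_bigr => t _; rewrite -mulrA; congr (_ * _).
rewrite [X in _ = _ * X]big_mkcond -big_split; apply: eq_bigr => i _ /=.
rewrite /expansion ffunE [RHS]/=; case: (i \in C) => /=; last by rewrite mulr1.
by rewrite mulNr mulr_natl.
Qed.

(** On the cycle C, a selection that is never mixed is constant. *)
Let det_cycle_block_sign x z i0 (C := porbit s i0) :
  \det (cycle_block x z C) = x ^+ #|C| + det_sign C * \prod_(i in C) z i.
Proof.
rewrite det_expansion (bigD1 [ffun=> true])//= expansion_det_cst.
rewrite (bigD1 [ffun i => i \notin C])/=; last first.
  by apply/eqP => /ffunP/(_ i0); rewrite !ffunE porbit_id.
rewrite expansion_det_cycle [X in _ + (_ + X)]big1 ?addr0// => f /andP[f1 f2].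
have [/existsP[i /andP[iC fi]]|/existsPn outC] := boolP [exists i, (i \notin C) && ~~ f i].
  apply: big1 => t _; rewrite (bigD1 i)//= /expansion (negbTE fi) (negbTE iC).
  by rewrite mul0r mulr0.
have [/existsP[i /and3P[iC fi fsi]]|/existsPn inC] :=
    boolP [exists i, [&& i \in C, ~~ f i & f (s^-1 i)%g]].
  exact: expansion_det_mixed iC fi fsi.
have step i : i \in C -> f (s^-1 i)%g -> f i.
  by move=> iC fsi; have := inC i; rewrite iC fsi andbT /= negbK.
have out i : i \notin C -> f i by move=> iC; have := outC i; rewrite iC /= negbK.
have fC i j : i \in C -> j \in C -> f i -> f j.
  move=> iC jC fi.
  have /porbitP[k ->] : j \in porbit s i.
    by move: iC jC; rewrite -!eq_porbit_mem => /eqP -> /eqP ->.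
  elim: k => [|k IHk]; first by rewrite expg0 perm1.
  apply: step; last by rewrite expgSr permM permK.
  by rewrite -eq_porbit_mem porbit_perm eq_porbit_mem.
have [fi0|fi0] := boolP (f i0).
  case/eqP: f1; apply/ffunP => i; rewrite ffunE.
  have [iC|/out//] := boolP (i \in C).
  by rewrite (fC i0)// porbit_id.
case/eqP: f2; apply/ffunP => i; rewrite ffunE.
have [iC|/out//] := boolP (i \in C).
by apply: contraNF fi0; apply: fC => //; exact: porbit_id.
Qed.

(** For x = 1 and z = 1 the matrix kills the indicator of C, so that its
    determinant vanishes; this forces the sign to be -1. *)
Lemma det_cycle_block x z i0 (C := porbit s i0) :
  \det (cycle_block x z C) = x ^+ #|C| - \prod_(i in C) z i.
Proof.
rewrite det_cycle_block_sign; congr (_ + _).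
have /esym/eqP := det_cycle_block_sign 1 (fun=> 1) i0.
rewrite expr1n big1_eq mulr1.
suff -> : \det (cycle_block 1 (fun=> 1) C) = 0.
  by rewrite addrC addr_eq0 => /eqP ->; rewrite mulN1r.
pose v : 'cV[K]_n := \col_i (i \in C)%:R.
have Bv : cycle_block 1 (fun=> 1) C *m v = 0.
  apply/colP => i; rewrite !mxE.
  under eq_bigr do rewrite !mxE.
  have [iC|iC] := boolP (i \in C).
    have siC : (s^-1 i)%g \in C.
      rewrite -eq_porbit_mem -(porbit_perm s 1) expg1 permKV.
      by rewrite eq_porbit_mem.
    under eq_bigr do rewrite mulrBl.
    rewrite sumrB (bigD1 i)//= [X in _ - X](bigD1 (s^-1 i)%g)//=.
    rewrite permKV !eqxx iC siC !big1 ?subrr// => j ji; rewrite ?mul0r//.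
      rewrite (_ : (i == s j) = false) ?mul0r//; apply: contraNF ji => /eqP ->.
      by rewrite permK.
    by rewrite eq_sym (negbTE ji) mul0r.
  rewrite big1// => j _; have [<-|] := eqVneq i j; last by rewrite mul0r.
  by rewrite (negbTE iC) mulr0.
have := congr1 (mulmx (\adj (cycle_block 1 (fun=> 1) C))) Bv.
rewrite mulmxA mul_adj_mx mulmx0 mul_scalar_mx => /colP/(_ i0).
by rewrite !mxE porbit_id mulr1.
Qed.

Lemma cycle_blockM x z C D : [disjoint C & D] ->
  (forall i, (s i \in C) = (i \in C)) ->
  cycle_block x z C *m cycle_block x z D = cycle_block x z (C :|: D).
Proof.
move=> CD sC; apply/matrixP => i j; rewrite !mxE finset.in_setU.
under eq_bigr do rewrite !mxE.
have [iC|iC] /= := boolP (i \in C); last first.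
  rewrite (bigD1 i)//= eqxx mul1r big1 ?addr0// => k ki.
  by rewrite eq_sym (negbTE ki) mul0r.
rewrite (bigD1 j)//= [X in _ + X]big1 ?addr0 => [|k kj]; last first.
  have [kD|kD] := boolP (k \in D); last by rewrite (negbTE kj) mulr0.
  have kC : k \notin C by apply: contraL kD => kC; rewrite (disjointFr CD kC).
  rewrite (_ : (i == k) = false); last by apply: contraNF kC => /eqP <-.
  rewrite (_ : (i == s k) = false) ?subrr ?mul0r//.
  by apply: contraNF kC => /eqP ik; rewrite -sC -ik.
have [jD|jD] := boolP (j \in D); last by rewrite eqxx mulr1.
have jC : j \notin C by apply: contraL jD => jC; rewrite (disjointFr CD jC).
rewrite (_ : (i == j) = false); last by apply: contraNF jC => /eqP <-.
rewrite (_ : (i == s j) = false) ?subrr ?mul0r//.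
by apply: contraNF jC => /eqP ij; rewrite -sC -ij.
Qed.

Lemma det_perm_block x z :
  \det (cycle_block x z [set: 'I_n]) =
  \prod_(C in porbits s) (x ^+ #|C| - \prod_(i in C) z i).
Proof.
have -> : [set: 'I_n] = \bigcup_(C <- enum (porbits s)) C.
  apply/esym/eqP; rewrite -finset.subTset big_enum; apply/fintype.subsetP => i _.
  by apply/bigcupP; exists (porbit s i); rewrite ?imset_f ?porbit_id.
rewrite -[RHS]big_enum /=.
have : {subset enum (porbits s) <= porbits s} by move=> C; rewrite mem_enum.
elim: (enum _) (enum_uniq (mem (porbits s))) => [_ _|C r IHr /= /andP[Cr Ur] sub].
  rewrite !big_nil -(det1 K n); congr (\det _).
  by apply/matrixP => i j; rewrite !mxE inE.
have /imsetP[i0 _ CE] := sub C (mem_head _ _).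
have sC i : (s i \in C) = (i \in C).
  by rewrite CE -!eq_porbit_mem -(porbit_perm s 1 i) expg1.
have CD : [disjoint C & \bigcup_(D <- r) D].
  rewrite -setI_eq0; apply/eqP/setP => i; rewrite !inE.
  apply/negP => /andP[iC]; rewrite big_seq.
  elim/big_ind: _ => [|D1 D2 H1 H2|D Dr iD]; first by rewrite inE.
    by rewrite inE => /orP[].
  have /imsetP[j0 _ DE] : D \in porbits s by rewrite sub// inE Dr orbT.
  case/negP: Cr; suff -> : C = D by [].
  by move: iC iD; rewrite CE DE -!eq_porbit_mem => /eqP <- /eqP.
rewrite !big_cons -cycle_blockM// det_mulmx IHr//; last first.
  by move=> D Dr; rewrite sub// inE Dr orbT.
by rewrite CE det_cycle_block.
Qed.

End CyclePolynomial.

Lemma char_poly_perm_matrix (R : realType) n (s : 'S_n) (z : n.-tuple R[i]) :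
  char_poly (perm_matrix (s, z)) =
  \prod_(C in porbits s) ('X^#|C| - (\prod_(i in C) tnth z i)%:P).
Proof.
rewrite /char_poly.
under eq_bigr do rewrite rmorph_prod.
rewrite -det_perm_block; congr (\det _); apply/matrixP => i j.
by rewrite !mxE inE /= rmorphM rmorph_nat mulr_natr.
Qed.

(** * Subsets of a partitioned set, classified by type *)

Section NestedSums.
Import mathcomp.boot.fintype mathcomp.boot.finset.
Variables (T : finType) (K : numFieldType).
Implicit Types (C J V : {set T}) (Z : {set {set T}}) (H : seq T -> K).
Implicit Types (B : seq (nat * nat)) (v : nat * nat).

Lemma sum_uniq_tuples_in (r : nat) C (g : {set T} -> K) :
  \sum_(x : r.-tuple T | uniq x && all [in C] x) g [set z in x] =
  r`!%:R * \sum_(V : {set T} | (V \subset C) && (#|V| == r)) g V.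
Proof.
rewrite (partition_big (fun x : r.-tuple T => [set z in x])
  (fun V => (V \subset C) && (#|V| == r)))/=; last first.
  move=> x /andP[Ux /allP xC]; rewrite cardsE (card_uniqP Ux) size_tuple eqxx.
  by rewrite andbT; apply/subsetP => z; rewrite inE; exact: xC.
rewrite mulr_sumr; apply: eq_bigr => V /andP[VC /eqP Vr].
rewrite (eq_bigr (fun=> g V)); last by move=> x /andP[_ /eqP ->].
rewrite sumr_const -[LHS]mulr_natl; congr (_%:R * _).
have Vr' : #|[pred z | z \in V]| = r by rewrite -Vr; apply: eq_card.
rewrite -ffactnn -[X in X ^_ _]Vr' -card_uniq_tuples.
rewrite cardsE; apply: eq_card => x; rewrite !unfold_in /=.
apply/andP/andP => [[/andP[Ux xC] /eqP xV]|[xV Ux]].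
  split; last exact: Ux.
  by apply/allP => z zx; rewrite /= -xV inE.
have Ex : [set z in x] = V.
  apply/eqP; rewrite eqEcard Vr cardsE (card_uniqP Ux) size_tuple leqnn andbT.
  by apply/subsetP => z; rewrite inE; exact: (allP xV).
split; last by rewrite Ex.
by rewrite Ux; apply/allP => z zx; apply: (subsetP VC); apply: (allP xV).
Qed.

(** The combinatorial counterpart of the measure tensor: each entry (k, r) of B
    picks a new block of size k and then r of its points, in order. *)
Fixpoint nested_sum B Z H : K :=
  if B is (k, r) :: B' then
    \sum_(C in Z | #|C| == k) \sum_(x : r.-tuple T | uniq x && all [in C] x)
      nested_sum B' (Z :\ C) (fun y => H (x ++ y))
  else H [::].

(** The number of choices in nested_sum that end up with the set J. *)
Fixpoint ways B Z J : K :=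
  if B is (k, r) :: B' then
    \sum_(C in Z | (#|C| == k) && (#|C :&: J| == r))
       r`!%:R * ways B' (Z :\ C) (J :\: C)
  else (J == set0)%:R.

Lemma trivIset_D1 Z C : trivIset Z -> trivIset (Z :\ C).
Proof. by apply: trivIsetS; rewrite subD1set. Qed.

Lemma disjoint_cover_D1 Z C : trivIset Z -> C \in Z -> [disjoint C & cover (Z :\ C)].
Proof.
move=> /trivIsetP tZ CZ; rewrite -setI_eq0; apply/eqP/setP => z; rewrite !inE.
apply/negP => /andP[zC /bigcupP[D]]; rewrite !inE => /andP[DC DZ] zD.
have := tZ _ _ CZ DZ; rewrite eq_sym DC => /(_ isT)/disjoint_setI0 /setP/(_ z).
by rewrite !inE zC zD.
Qed.

Lemma cover_D1 Z C : trivIset Z -> C \in Z -> cover Z = C :|: cover (Z :\ C).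
Proof.
by move=> tZ CZ; rewrite /cover (bigD1 C)//=; congr (_ :|: _);
  apply: eq_bigl => D; rewrite !inE andbC.
Qed.

(** A subset of the union of Z amounts to its trace on C and its trace on the
    other blocks. *)
Lemma sum_subset_split Z C (r : nat) (f : {set T} -> {set T} -> K) :
  trivIset Z -> C \in Z ->
  \sum_(V : {set T} | (V \subset C) && (#|V| == r))
    \sum_(J : {set T} | J \subset cover (Z :\ C)) f (V :|: J) J =
  \sum_(J : {set T} | (J \subset cover Z) && (#|C :&: J| == r)) f J (J :\: C).
Proof.
move=> tZ CZ; have CD := disjoint_cover_D1 tZ CZ; have cZ := cover_D1 tZ CZ.
rewrite pair_big/=.
rewrite (reindex_onto (fun J => (C :&: J, J :\: C)) (fun p => p.1 :|: p.2))/=.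
  have E J : C :&: J :|: J :\: C = J by rewrite setIC setID.
  apply: eq_big => [J|J _]; last by rewrite E.
  by rewrite subsetIl E eqxx andbT cZ /= andbC subDset.
move=> [V J] /= /andP[/andP[VC _] JZ].
have JC : [disjoint C & J] by apply: disjointWr CD.
congr (_, _).
  by rewrite setIUr (setIidPr VC) (disjoint_setI0 JC) setU0.
rewrite setDUl (eqP (_ : V :\: C == set0)) ?set0U; last by rewrite setD_eq0.
by apply/setDidPl; rewrite disjoint_sym.
Qed.

Lemma nested_sum_ways B Z H : trivIset Z ->
  (forall x y, perm_eq x y -> H x = H y) ->
  nested_sum B Z H = \sum_(J : {set T} | J \subset cover Z) ways B Z J * H (enum J).
Proof.
elim: B Z H => [|[k r] B IHB] Z H tZ symH /=.
  rewrite (bigD1 set0) ?sub0set//= eqxx mul1r enum_set0 big1 ?addr0//.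
  by move=> J /andP[_ /negbTE ->]; rewrite mulr0n mul0r.
under [RHS]eq_bigr do rewrite mulr_suml.
rewrite [RHS](exchange_big_dep [in Z])/=; last by move=> J C _ /andP[].
rewrite big_mkcondr; apply: eq_bigr => C CZ /=.
case: ifP => [kC|kC]; last by rewrite big_pred0// => J; rewrite CZ /= andbF.
have CD := disjoint_cover_D1 tZ CZ.
pose f J' J := ways B (Z :\ C) J * H (enum J').
have xE (x : r.-tuple T) : uniq x && all [in C] x ->
    nested_sum B (Z :\ C) (fun y => H (x ++ y)) =
    \sum_(J : {set T} | J \subset cover (Z :\ C)) f ([set z in x] :|: J) J.
  move=> /andP[Ux xC]; rewrite IHB ?trivIset_D1//; last first.
    by move=> y1 y2 y12; apply: symH; rewrite perm_cat2l.
  apply: eq_bigr => J JZ; congr (_ * _); apply: symH; apply: uniq_perm.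
  - rewrite cat_uniq Ux enum_uniq andbT /=; apply/hasPn => z /=.
    rewrite mem_enum => zJ; apply/negP => /(allP xC) zC.
    by move: (disjointFr CD zC); rewrite (subsetP JZ).
  - exact: enum_uniq.
  - by move=> z; rewrite mem_cat !mem_enum !inE.
rewrite (eq_bigr _ xE).
rewrite (sum_uniq_tuples_in r C (fun V =>
  \sum_(J : {set T} | J \subset cover (Z :\ C)) f (V :|: J) J)).
rewrite (sum_subset_split r f tZ CZ) mulr_sumr.
by apply: eq_big => [J|J _]; rewrite ?CZ//= mulrA.
Qed.

(** The type of J: only the blocks that J meets matter. *)
Definition labels Z J : seq (nat * nat) :=
  [seq (#|C|, #|C :&: J|) | C <- enum Z & C :&: J != set0].

(** The product of the factorials of the multiplicities in B, in the form that
    an induction on B produces. *)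
Fixpoint count_orders B : nat :=
  if B is v :: B' then (count_mem v B * count_orders B')%N else 1.

Lemma labels_nil Z J : J \subset cover Z -> (labels Z J == [::]) = (J == set0).
Proof.
move=> JZ; apply/eqP/eqP => [lab0|->]; last first.
  by rewrite /labels (eq_filter (a2 := pred0)) ?filter_pred0// => C; rewrite setI0 eqxx.
apply/setP => z; rewrite inE; apply/negP => zJ.
have /bigcupP[C CZ zC] := subsetP JZ z zJ.
have : (#|C|, #|C :&: J|) \in labels Z J.
  apply/mapP; exists C => //; rewrite mem_filter mem_enum CZ andbT.
  by apply/set0Pn; exists z; rewrite inE zC.
by rewrite lab0.
Qed.

Lemma labels_D1 Z J C : trivIset Z -> C \in Z -> C :&: J != set0 ->
  perm_eq (labels Z J) ((#|C|, #|C :&: J|) :: labels (Z :\ C) (J :\: C)).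
Proof.
move=> tZ CZ CJ.
have pZ : perm_eq (enum Z) (C :: enum (Z :\ C)).
  apply: uniq_perm => /=; rewrite ?mem_enum ?inE ?eqxx ?enum_uniq// => D.
  rewrite inE !mem_enum !inE; case: eqVneq => //= ->.
  by rewrite CZ.
apply: (perm_trans (perm_map _ (perm_filter _ pZ))) => /=; rewrite CJ /=.
rewrite perm_cons /labels.
have E D : D \in enum (Z :\ C) -> D :&: (J :\: C) = D :&: J.
  rewrite mem_enum !inE => /andP[DC DZ]; apply/setP => z; rewrite !inE.
  case zD : (z \in D) => //=; have := trivIsetP tZ _ _ DZ CZ DC.
  by move=> /disjointFr/(_ zD) ->.
rewrite (eq_in_filter (a2 := fun D => D :&: (J :\: C) != set0)); last first.
  by move=> D /E ->.
rewrite (iffLR (eq_in_map _ (fun D : {set T} => (#|D|, #|D :&: (J :\: C)|)) _)); last first.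
  by move=> D; rewrite mem_filter => /andP[_ /E ->].
by [].
Qed.

(** The set J can only be reached along its own type. The first block is then
    any of those with the right label, which are as many as the entries of B
    equal to it, and its r points come in r! orders. *)
Lemma waysE B Z J : trivIset Z -> J \subset cover Z ->
  all (fun v => 0 < v.2)%N B ->
  ways B Z J = (perm_eq B (labels Z J))%:R *
    ((\prod_(v <- B) v.2`!) * count_orders B)%:R.
Proof.
elim: B Z J => [|[k r] B IHB] Z J tZ JZ /=.
  move=> _; rewrite big_nil mul1n mulr1 -(labels_nil JZ).
  congr (_%:R); congr (nat_of_bool _); apply/eqP/idP => [->//|].
  by rewrite perm_sym => /perm_nilP.
move=> /andP[r0 Bpos].
have r0' C : #|C :&: J| == r -> C :&: J != set0.
  by move=> /eqP Cr; rewrite -card_gt0 Cr.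
rewrite (eq_bigr (fun=> (perm_eq ((k, r) :: B) (labels Z J))%:R *
    (r`! * ((\prod_(v <- B) v.2`!) * count_orders B))%:R)).
  rewrite sumr_const -[LHS]mulr_natl.
  have [pB|] := boolP (perm_eq _ _); last by rewrite !mul0r mulr0.
  rewrite !mul1r -natrM big_cons /=; congr (_%:R).
  have /seq.permP/(_ (pred1 (k, r))) /= := pB.
  rewrite eqxx => ->.
  suff -> : count (pred1 (k, r)) (labels Z J) =
      #|[pred C in Z | (#|C| == k) && (#|C :&: J| == r)]|.
    rewrite mulnCA -mulnA; congr (_ * _)%N; exact: mulnCA.
  rewrite /labels count_map count_filter -size_filter cardE.
  rewrite -(size_map id); apply: perm_size; apply: uniq_perm.
  - by rewrite map_id filter_uniq ?enum_uniq.
  - exact: enum_uniq.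
  - move=> C; rewrite map_id mem_filter !mem_enum !inE /= xpair_eqE.
    case: (C \in Z); rewrite ?andbF ?andbT//=; case: (_ == k) => //=.
    by case rC : (_ == r) => //=; exact: r0'.
move=> C /and3P[CZ /eqP kC rC].
have pl := labels_D1 tZ CZ (r0' _ rC).
rewrite IHB ?trivIset_D1//; last first.
  by rewrite subDset; have := JZ; rewrite (cover_D1 tZ CZ).
have -> : perm_eq B (labels (Z :\ C) (J :\: C)) = perm_eq ((k, r) :: B) (labels Z J).
  rewrite (permPr pl) kC (eqP rC) perm_cons.
  by [].
by rewrite mulrCA !natrM.
Qed.

End NestedSums.

Section Families.
Import mathcomp.boot.fintype mathcomp.boot.finset.
Local Notation family := {fsfun nat * nat -> nat with 0%N}.
Implicit Types (l : family) (v : nat * nat) (s : seq (nat * nat)).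

Let spread (g : nat * nat -> nat) s := flatten [seq nseq (g v) v | v <- s].

Let count_mem_spread g s v : uniq s ->
  count_mem v (spread g s) = if v \in s then g v else 0%N.
Proof.
elim: s => //= w s IHs /andP[ws Us]; rewrite /spread /= count_cat.
rewrite -/(spread g s) IHs// count_nseq /= inE (eq_sym v w).
by have [<-|_] /= := eqVneq w v; rewrite ?(negbTE ws) ?addn0 ?mul1n.
Qed.

Lemma count_mem_blocks l v : count_mem v (blocks l) = l v.
Proof.
rewrite [LHS]count_mem_spread ?fset_uniq//.
by have [//|/fsfun_dflt ->] := boolP (v \in finsupp l).
Qed.

Lemma mem_blocks l v : (v \in blocks l) = (v \in finsupp l).
Proof. by rewrite -has_pred1 has_count count_mem_blocks lt0n mem_finsupp. Qed.

Lemma count_orders_blocks l :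
  count_orders (blocks l) = (\prod_(v <- finsupp l) (l v)`!)%N.
Proof.
rewrite /blocks; elim: (enum_fset _) (fset_uniq (finsupp l)) => [_|w s IHs] /=.
  by rewrite big_nil.
move=> /andP[ws Us]; rewrite big_cons -IHs//.
have ws' : count_mem w (flatten [seq nseq (l v) v | v <- s]) = 0%N.
  by rewrite [LHS]count_mem_spread// (negbTE ws).
elim: (l w) => [|n IHn]; first by rewrite fact0 mul1n.
by rewrite /= IHn factS mulnA count_cat count_nseq ws' /= eqxx mul1n addn0 add1n.
Qed.

Lemma sum_blocks l (g : nat * nat -> nat) :
  (\sum_(v <- blocks l) g v = \sum_(v <- finsupp l) g v * l v)%N.
Proof.
rewrite big_flatten big_map; apply: eq_bigr => v _.
by rewrite big_nseq iter_addn_0.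
Qed.

Lemma prod_blocks (K : comNzRingType) l (g : nat * nat -> K) :
  \prod_(v <- blocks l) g v = \prod_(v <- finsupp l) g v ^+ l v.
Proof.
rewrite big_flatten big_map; apply: eq_bigr => v _.
by rewrite big_nseq iter_mulr_1.
Qed.

Definition family_of s : family :=
  [fsfun v in seq_fset tt s => count_mem v s].

Lemma family_ofE s v : family_of s v = count_mem v s.
Proof.
rewrite fsfunE seq_fsetE; case: ifP => // /negbT.
by rewrite -has_pred1 has_count -leqNgt leqn0 => /eqP.
Qed.

Lemma perm_blocks l s : perm_eq (blocks l) s = (l == family_of s).
Proof.
apply/idP/eqP => [/seq.permP ls|->].
  by apply/fsfunP => v; rewrite family_ofE -ls count_mem_blocks.
by apply/allP => v _ /=; rewrite count_mem_blocks family_ofE.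
Qed.

Section Types.
Variables (T : finType) (K : numFieldType).
Implicit Types (C J : {set T}) (Z : {set {set T}}) (H : seq T -> K).

Lemma sum_labels Z J : trivIset Z -> J \subset cover Z ->
  (\sum_(v <- labels Z J) v.2 = #|J|)%N.
Proof.
move=> tZ JZ; rewrite big_map big_filter big_enum_cond /=.
transitivity (\sum_(C in Z) \sum_(z in C) if z \in J then 1 else 0)%N.
  rewrite big_mkcondr; apply: eq_bigr => C _.
  rewrite -big_mkcondr sum1_card.
  case: ifPn => [_|/negPn/eqP CJ]; first by apply: eq_card => z; rewrite !inE.
  by rewrite -(cards0 T) -CJ; apply: eq_card => z; rewrite !inE.
rewrite -big_trivIset// -big_mkcondr sum1_card; apply: eq_card => z.
by rewrite unfold_in /= andbC; case zJ : (z \in J) => //=; rewrite (subsetP JZ).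
Qed.

Lemma sum_labels_size Z J : trivIset Z ->
  (\sum_(v <- labels Z J) v.1 <= #|T|)%N.
Proof.
move=> /eqP tZ; rewrite big_map big_filter big_enum_cond /= big_mkcondr.
apply: (@leq_trans (\sum_(C in Z) #|C|)).
  by apply: leq_sum => C _; case: ifP.
by rewrite tZ max_card.
Qed.

Lemma labels_gt0 Z J v : v \in labels Z J -> (0 < v.1)%N && (0 < v.2)%N.
Proof.
case/mapP => C; rewrite mem_filter -card_gt0 => /andP[CJ _] -> /=.
by rewrite CJ andbT (leq_trans CJ)// subset_leq_card ?subsetIl.
Qed.

Lemma family_of_labels Z J (q : nat) : trivIset Z -> J \subset cover Z ->
  #|J| = q -> Ltilde #|T| q (family_of (labels Z J)).
Proof.
move=> tZ JZ Jq; have P : perm_eq (blocks (family_of (labels Z J))) (labels Z J).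
  by rewrite perm_blocks.
split=> [v| |].
- by rewrite -mem_blocks (perm_mem P) => /labels_gt0.
- by rewrite -sum_blocks (perm_big _ P) sum_labels.
- by rewrite /weight -sum_blocks (perm_big _ P) sum_labels_size.
Qed.

(** The inverse of the number of times that a set of type l is reached. *)
Definition symmetry_factor l : K :=
  \prod_(v <- finsupp l) ((l v)`!%:R^-1 * v.2`!%:R^-1 ^+ l v).

Lemma Ltilde_blocks_gt0 (N q : nat) l : Ltilde N q l ->
  all (fun v => 0 < v.1)%N (blocks l) /\ all (fun v => 0 < v.2)%N (blocks l).
Proof.
by move=> [l0 _ _]; split; apply/allP => v; rewrite mem_blocks => /l0/andP[].
Qed.

Lemma symmetry_factor_ways (N q : nat) l Z J : trivIset Z -> J \subset cover Z ->
  Ltilde N q l ->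
  symmetry_factor l * ways K (blocks l) Z J = (perm_eq (blocks l) (labels Z J))%:R.
Proof.
move=> tZ JZ Ll; rewrite waysE//; last by have [] := Ltilde_blocks_gt0 Ll.
rewrite mulrCA -[RHS]mulr1; congr (_ * _).
rewrite natrM natr_prod prod_blocks count_orders_blocks natr_prod.
rewrite -!big_split big1//= => v _.
have nz n : n`!%:R != 0 :> K by rewrite pnatr_eq0 -lt0n fact_gt0.
rewrite exprVn -mulrA [X in _ * X]mulrA mulVf ?expf_neq0// mul1r.
by rewrite mulVf.
Qed.

(** Every set of q points is reached by the choices of exactly one type, and
    the symmetry factor compensates for the number of times. *)
Lemma sum_over_types Z (q : nat) H : trivIset Z -> cover Z = setT ->
  (forall x y, perm_eq x y -> H x = H y) ->
  \sum_(l <- fset_set (Ltilde #|T| q)) symmetry_factor l * nested_sum (blocks l) Z H =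
  \sum_(J : {set T} | #|J| == q) H (enum J).
Proof.
move=> tZ cZ symH; have JZ J : J \subset cover Z by rewrite cZ subsetT.
have inL l : l \in fset_set (Ltilde #|T| q) -> Ltilde #|T| q l.
  by rewrite (in_fset_set (finite_Ltilde _ _)) => /set_mem.
under eq_bigr do rewrite nested_sum_ways// mulr_sumr.
rewrite exchange_big/= [RHS]big_mkcond/=.
rewrite (eq_bigl predT) => [|J]; last by rewrite JZ.
apply: eq_bigr => J _.
under eq_bigr do rewrite mulrA.
rewrite -mulr_suml big_seq.
under eq_bigr => l /inL Ll do rewrite (symmetry_factor_ways tZ (JZ J) Ll).
case: eqP => Jq; last first.
  rewrite big1 ?mul0r// => l /inL Ll.
  case: (boolP (perm_eq _ _)) => // P; case: Jq.
  by rewrite -(sum_labels tZ (JZ J)) -(perm_big _ P) sum_blocks; case: Ll.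
rewrite -big_seq (bigD1_seq (family_of (labels Z J))) ?fset_uniq//=; last first.
  rewrite (in_fset_set (finite_Ltilde _ _)); apply: mem_set; exact: family_of_labels.
rewrite perm_blocks eqxx big1 ?addr0 ?mul1r// => l ll.
by rewrite perm_blocks (negbTE ll).
Qed.

End Types.
End Families.

(** * A measurable root on the complex plane *)

Section MeasurableRoot.
Local Open Scope classical_set_scope.
Context {R : realType}.
Implicit Types (z : R[i]) (k : nat).

Definition modulus z : R := (complex.Re z ^+ 2 + complex.Im z ^+ 2) `^ 2^-1.

(** The half-angle formula tan (a / 2) = y / (r + x), which fails only on the
    nonpositive half-axis. The base of the power is nonnegative, so that the
    exponent -1 gives its inverse. *)
Definition angle z : R :=
  if modulus z + complex.Re z == 0 then pi
  else atan (complex.Im z * (modulus z + complex.Re z) `^ (-1)) *+ 2.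

Definition croot k z : R[i] :=
  let r := modulus z `^ k%:R^-1 in
  Complex (r * cos (angle z / k%:R)) (r * sin (angle z / k%:R)).

Lemma measurable_croot k : measurable_fun setT (croot k).
Proof.
have [mRe mIm] : measurable_fun setT (@complex.Re R) /\ measurable_fun setT (@complex.Im R).
  by apply/(@measurable_complexP R _ _ id); exact: measurable_id.
have mmod : measurable_fun setT modulus.
  apply: (measurableT_comp (measurable_powR _)).
  by apply: measurable_funD; exact: measurable_funX.
have mang : measurable_fun setT angle.
  apply: measurable_fun_ifT => //.
    by apply: measurable_fun_eqr => //; apply: measurable_funD.
  under eq_fun do rewrite -mulr_natr; apply: measurable_funM => //.
  apply: (measurableT_comp (continuous_measurable_fun (@continuous_atan R))).
  apply: measurable_funM => //.
  by apply: (measurableT_comp (measurable_powR _)); apply: measurable_funD.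
apply/measurable_complexP; split=> /=; apply: measurable_funM.
- exact: (measurableT_comp (measurable_powR _)).
- apply: (measurableT_comp (continuous_measurable_fun (@continuous_cos R))).
  exact: measurable_funM.
- exact: (measurableT_comp (measurable_powR _)).
- apply: (measurableT_comp (continuous_measurable_fun (@continuous_sin R))).
  exact: measurable_funM.
Qed.

Lemma de_moivre (a : R) k :
  Complex (cos a) (sin a) ^+ k = Complex (cos (a *+ k)) (sin (a *+ k)).
Proof.
elim: k => [|k IHk]; first by rewrite expr0 mulr0n cos0 sin0.
by rewrite exprS IHk mulrS cosD sinD; congr Complex; rewrite // addrC.
Qed.

Lemma modulus_sqr z : modulus z ^+ 2 = complex.Re z ^+ 2 + complex.Im z ^+ 2.
Proof.
have h : 0 <= complex.Re z ^+ 2 + complex.Im z ^+ 2.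
  by rewrite addr_ge0 ?sqr_ge0.
by rewrite /modulus -powR_mulrn ?powR_ge0// -powRrM mulVf// powRr1.
Qed.

Lemma polar z : z = Complex (modulus z * cos (angle z)) (modulus z * sin (angle z)).
Proof.
have m2 := modulus_sqr z; have m0 : 0 <= modulus z by exact: powR_ge0.
rewrite /angle; case: z => x y /= in m2 m0 *; set r := modulus _ in m2 m0 *.
have rx : 0 <= r + x.
  have : `|x| <= `|r| by rewrite -ler_sqr ?nnegrE// !real_normK ?num_real// m2 lerDl sqr_ge0.
  by rewrite (ger0_norm m0) ler_norml => /andP[]; rewrite -subr_ge0 opprK addrC.
case: eqP => [/eqP|/eqP rx0].
  rewrite addr_eq0 => /eqP rx'; rewrite cospi sinpi mulr0 mulrN1.
  have : y ^+ 2 = 0 by move: m2; rewrite rx' sqrrN; lra.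
  by move=> /eqP; rewrite sqrf_eq0 => /eqP ->; rewrite rx' opprK.
rewrite powR_inv1//; set t := y / (r + x).
have c0 : cos (atan t) != 0.
  by rewrite cos_atan invr_eq0 gt_eqF// sqrtr_gt0 ltr_pwDl// sqr_ge0.
have st : sin (atan t) = t * cos (atan t).
  by rewrite -[X in X * _]atanK /tan divfK.
have ct : cos (atan t) ^+ 2 * (1 + t ^+ 2) = 1.
  by rewrite -[RHS](cos2Dsin2 (atan t)) st; ring.
have tE : t * (r + x) = y by rewrite divfK.
have rE : r + x = 2 * r * cos (atan t) ^+ 2.
  apply: (mulfI rx0); rewrite [RHS](_ : _ = (2 * r * (r + x)) * cos (atan t) ^+ 2); last by ring.
  rewrite (_ : 2 * r * (r + x) = (r + x) ^+ 2 * (1 + t ^+ 2)).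
    by rewrite -mulrA [(1 + t ^+ 2) * _]mulrC ct mulr1 expr2.
  rewrite [RHS]mulrDr mulr1 -exprMn [(r + x) * t]mulrC tE.
  have -> : y ^+ 2 = r ^+ 2 - x ^+ 2 by rewrite m2; ring.
  by ring.
rewrite cos_mulr2n sin_mulr2n st; congr Complex.
  by rewrite -[LHS](addKr r) rE; ring.
by rewrite -[LHS]tE rE; ring.
Qed.

Lemma croot_expn k z : (0 < k)%N -> croot k z ^+ k = z.
Proof.
move=> k0; have k0' : k%:R != 0 :> R by rewrite pnatr_eq0 -lt0n.
have E (r a : R) : Complex (r * cos a) (r * sin a) = r%:C%C * Complex (cos a) (sin a).
  by rewrite /real_complex_def; congr Complex; rewrite mul0r ?subr0 ?addr0.
rewrite /croot E exprMn de_moivre -rmorphXn -powR_mulrn ?powR_ge0// -powRrM.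
rewrite mulVf// powRr1 ?powR_ge0// -[_ *+ k]mulr_natr divfK//.
by rewrite -E -polar.
Qed.

End MeasurableRoot.

(** * Sums over injective selections *)

Section Selections.
Import mathcomp.boot.fintype mathcomp.boot.finset.
Local Open Scope ereal_scope.
Context {R : realType}.
Implicit Types (r : nat).

(** Stated on lists, this depends on s only up to permutation; neither the
    eigenvalues nor the roots of unity come in a specified order. *)
Fixpoint selection_sum (V : eqType) r (s : seq V) (f : seq V -> \bar R) : \bar R :=
  if r is r'.+1 then \sum_(v <- s) selection_sum r' (rem v s) (fun y => f (v :: y))
  else f [::].

Lemma perm_rem_eq (V : eqType) (s1 s2 : seq V) v :
  perm_eq s1 s2 -> perm_eq (rem v s1) (rem v s2).
Proof.
move=> p12; have [v1|v1] := boolP (v \in s1); last first.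
  by rewrite !rem_id// -(perm_mem p12).
rewrite -(perm_cons v) -(permPl (perm_to_rem v1)) (permPl p12).
by apply: perm_to_rem; rewrite -(perm_mem p12).
Qed.

Lemma perm_selection_sum (V : eqType) r (s1 s2 : seq V) f :
  perm_eq s1 s2 -> selection_sum r s1 f = selection_sum r s2 f.
Proof.
elim: r s1 s2 f => //= r IHr s1 s2 f p12.
rewrite (perm_big _ p12) /=; apply: eq_bigr => v _.
exact: IHr (perm_rem_eq v p12).
Qed.

Lemma eq_selection_sum (V : eqType) r (s : seq V) f g :
  f =1 g -> selection_sum r s f = selection_sum r s g.
Proof.
elim: r s f g => /= [|r IHr] s f g fg; first exact: fg.
by apply: eq_bigr => v _; apply: IHr => y; exact: fg.
Qed.

Lemma sum_uniq_tuples (V : eqType) (T : finType) r (P : pred T) (a : T -> V)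
    (f : seq V -> \bar R) :
  \sum_(x : r.-tuple T | uniq x && all P x) f (map a x) =
  selection_sum r [seq a i | i <- enum P] f.
Proof.
elim: r P f => [|r IHr] P f /=.
  by rewrite (big_pred1 [tuple])// => x; rewrite tuple0 /= eqxx.
rewrite big_map big_enum /=.
have bij : {on [pred x : r.+1.-tuple T | uniq x && all P x],
    bijective (fun p : T * r.-tuple T => [tuple of p.1 :: p.2])}.
  apply: onW_bij; exists (fun x : r.+1.-tuple T => (thead x, [tuple of behead x])).
    by move=> [i y]; congr pair; apply: val_inj.
  by move=> x; rewrite -tuple_eta.
rewrite (reindex _ bij)/=.
rewrite (eq_bigl (fun p : T * r.-tuple T => P p.1 && (uniq p.2 && all (predD1 P p.1) p.2))).
  rewrite -(pair_big_dep P (fun i (y : r.-tuple T) => uniq y && all (predD1 P i) y)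
    (fun i y => f (a i :: map a y)))/=.
  apply: eq_bigr => i Pi; rewrite (IHr (predD1 P i) (fun y => f (a i :: y))).
  apply: perm_selection_sum; rewrite -(perm_cons (a i)).
  rewrite -(permPr (perm_to_rem _)); last by apply: map_f; rewrite mem_enum.
  rewrite -map_cons; apply: perm_map; apply: uniq_perm => /=.
  - by rewrite mem_enum inE /= eqxx enum_uniq.
  - exact: enum_uniq.
  - move=> j; rewrite inE !mem_enum !inE /=; case: eqVneq => // ->.
    by rewrite [RHS]Pi.
move=> [i y] /=.
have -> : all (predD1 P i) y = (i \notin tval y) && all P y.
  elim: (tval y) => //= j y' ->; rewrite inE negb_or (eq_sym i).
  by rewrite -andbA -[in RHS]andbA; congr (_ && _); rewrite andbCA.
by case: (i \notin tval y); case: (uniq y); case: (P i); rewrite ?andbF.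
Qed.

End Selections.

Section NestedSelections.
Import mathcomp.boot.fintype mathcomp.boot.finset.
Local Open Scope ereal_scope.
Context {R : realType} {T : finType} {V : eqType}.
Implicit Types (B : seq (nat * nat)) (Z : {set {set T}}) (blk : {set T} -> seq V).

(** The same as nested_sum for the values carried by the blocks instead of
    their points. *)
Fixpoint nested_selection B Z blk (F : seq V -> \bar R) : \bar R :=
  if B is (k, r) :: B' then
    \sum_(C in Z | #|C| == k) selection_sum r (blk C)
      (fun y => nested_selection B' (Z :\ C) blk (fun y' => F (y ++ y')))
  else F [::].

Lemma perm_nested_selection B Z blk1 blk2 F :
  (forall C, C \in Z -> perm_eq (blk1 C) (blk2 C)) ->
  nested_selection B Z blk1 F = nested_selection B Z blk2 F.
Proof.
elim: B Z F => [//|[k r] B IHB] Z F blk12 /=.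
apply: eq_bigr => C /andP[CZ _]; rewrite (perm_selection_sum _ _ (blk12 C CZ)).
apply: eq_selection_sum => y; apply: IHB => D /setD1P[_ DZ].
exact: blk12.
Qed.

Lemma EFin_nested_sum B Z (h : seq V -> R) (w : T -> V) :
  (nested_sum B Z (fun x => h (map w x)))%:E =
  nested_selection B Z (fun C => [seq w i | i <- enum C]) (fun y => (h y)%:E).
Proof.
elim: B Z h => [//|[k r] B IHB] Z h /=.
rewrite -sumEFin; apply: eq_bigr => C _; rewrite -sumEFin.
rewrite -[RHS](sum_uniq_tuples r [in C] w); apply: eq_bigr => x _.
rewrite -(IHB _ (fun y => h ([seq w i | i <- x] ++ y))); congr (_%:E).
by congr nested_sum; apply/funext => y; rewrite map_cat.
Qed.

End NestedSelections.

Section PointCorrelation.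
Import mathcomp.boot.fintype mathcomp.boot.finset.
Context {R : realType} {q : nat} (A : set (q.-tuple R[i])).

(** The value 0 on the words of another length makes the function invariant
    under the rearrangements of all words. *)
Definition symmetric_indic (y : seq R[i]) : R :=
  if size y == q then \sum_(s : 'S_q) \1_A [tuple y`_(s i) | i < q] else 0.

Lemma perm_symmetric_indic x y :
  perm_eq x y -> symmetric_indic x = symmetric_indic y.
Proof.
move=> pxy; rewrite /symmetric_indic -(perm_size pxy); case: eqP => // xq.
have yq : size y == q by rewrite -(perm_size pxy) xq.
have /tuple_permP[p xE] : perm_eq x (Tuple yq) by [].
rewrite [RHS](reindex_inj (mulIg p))/=; apply: eq_bigr => s _.
congr (\1_A _); apply: eq_from_tnth => i; rewrite !tnth_mktuple xE /=.
rewrite (nth_map i) ?size_enum_ord// nth_ord_enum permM.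
by rewrite (tnth_nth 0).
Qed.

(** Averaging over the q! orders of a tuple of indices replaces the
    indicator of A by its symmetrisation, whose value depends only on the
    set of indices. *)
Lemma point_correlationE N (M : 'M[R[i]]_N) (w : 'I_N -> R[i]) :
  perm_eq (eigenvalues M) [seq w i | i <- enum 'I_N] ->
  point_correlation q M A =
  (\sum_(J : {set 'I_N} | #|J| == q) symmetric_indic [seq w i | i <- enum J])%:E.
Proof.
move=> pw; pose g (y : seq R[i]) : R := \1_A [tuple y`_i | i < q].
have -> : point_correlation q M A =
    (\sum_(j : q.-tuple 'I_N | uniq j) (g [seq w i | i <- j])%:E)%E.
  rewrite /= /mfsum.
  transitivity (\sum_(j : q.-tuple 'I_N | uniq j && all predT j)
      (g [seq (eigenvalues M)`_i | i : 'I_N <- j])%:E)%E.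
    apply: eq_big => [j|j _]; first by rewrite all_predT andbT.
    rewrite diracE /g indicE; congr ((_ \in A)%:R%:E).
    by apply: eq_from_tnth => i; rewrite tnth_mktuple (tnth_nth 0).
  rewrite (sum_uniq_tuples q predT (fun i : 'I_N => (eigenvalues M)`_i) (fun y => (g y)%:E)).
  rewrite (_ : [seq (eigenvalues M)`_i | i : 'I_N <- enum predT] = eigenvalues M); last first.
    rewrite -[RHS](mkseq_nth 0) /mkseq size_eigenvalues -val_enum_ord -map_comp.
    by apply: eq_map.
  rewrite (perm_selection_sum _ _ pw).
  rewrite -(sum_uniq_tuples q predT w (fun y => (g y)%:E)).
  by apply: eq_bigl => j; rewrite all_predT andbT.
rewrite sumEFin; congr (_%:E).
have nzq : q`!%:R != 0 :> R by rewrite pnatr_eq0 -lt0n fact_gt0.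
apply: (mulfI nzq).
have -> : q`!%:R * \sum_(J : {set 'I_N} | #|J| == q) symmetric_indic [seq w i | i <- enum J] =
    \sum_(j : q.-tuple 'I_N | uniq j) symmetric_indic [seq w i | i <- j].
  have := sum_uniq_tuples_in q [set: 'I_N]
    (fun J => symmetric_indic [seq w i | i <- enum J]).
  rewrite [X in _ = _ * X](eq_bigl (fun J : {set 'I_N} => #|J| == q)) => [<-|J]; last first.
    by rewrite subsetT.
  apply: eq_big => [j|j /andP[Uj _]].
    by rewrite (_ : all _ j) ?andbT//; apply/allP => i _; rewrite inE.
  apply: perm_symmetric_indic; apply: perm_map; apply: uniq_perm => //.
    exact: enum_uniq.
  by move=> i; rewrite mem_enum inE.
under [RHS]eq_bigr do rewrite /symmetric_indic size_map size_tuple eqxx.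
rewrite exchange_big/= -[in LHS](card_Sn q) mulr_natl -sumr_const.
apply: eq_bigr => s _; pose h (j : q.-tuple 'I_N) := [tuple tnth j (s i) | i < q].
have hinj : injective h.
  move=> j1 j2 /(congr1 (fun j => tnth j)) E; apply: eq_from_tnth => i.
  by have := congr1 (fun f => f (s^-1%g i)) E; rewrite !tnth_mktuple permKV.
rewrite (reindex_inj hinj); apply: eq_big => [j|j _].
  by apply: perm_uniq; apply/tuple_permP; exists s.
rewrite /g; congr (\1_A _); apply: eq_from_tnth => i; rewrite !tnth_mktuple.
rewrite (nth_map (tnth j i)) ?size_tuple// -tnth_nth.
by rewrite tnth_mktuple (nth_map (tnth j i)) ?size_tuple// -tnth_nth.
Qed.

End PointCorrelation.

(** * The eigenvalues of a weighted permutation matrix *)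

Section CycleEigenvalues.
Import mathcomp.boot.fintype mathcomp.boot.finset.
Context {R : realType}.
Implicit Types (k : nat) (c : R[i]).

Lemma unity_rootsE k : (0 < k)%N ->
  'X^k - 1 = \prod_(u <- unity_roots k) ('X - (u : R[i])%:P).
Proof.
move=> k0; rewrite {1}[LHS]crootsE lead_coefDl ?lead_coefXn ?scale1r//.
by rewrite size_polyN size_polyXn size_poly1.
Qed.

Lemma size_unity_roots k : (0 < k)%N -> size (unity_roots k : seq R[i]) = k.
Proof.
move=> k0; have := congr1 (fun p : {poly R[i]} => size p) (unity_rootsE k0).
by rewrite size_prod_XsubC size_XnsubC// => -[].
Qed.

Lemma uniq_unity_roots k : (0 < k)%N -> uniq (unity_roots k : seq R[i]).
Proof.
move=> k0; rewrite -separable.separable_prod_XsubC -unity_rootsE//.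
by apply: cyclotomic.separable_Xn_sub_1; rewrite pnatr_eq0 -lt0n.
Qed.

Lemma XnsubC_unity_roots k c : (0 < k)%N ->
  'X^k - (c ^+ k)%:P = \prod_(u <- [seq c * u | u <- unity_roots k]) ('X - u%:P).
Proof.
move=> k0; rewrite big_map; have [->|c0] := eqVneq c 0.
  under eq_bigr do rewrite mul0r subr0.
  by rewrite expr0n gtn_eqF// subr0 big_const_seq count_predT iter_mulr_1 size_unity_roots.
apply: (@mulfI _ ((c ^- k)%:P)); first by rewrite polyC_eq0 invr_eq0 expf_neq0.
have := congr1 (comp_poly (c^-1 *: 'X)) (unity_rootsE k0).
rewrite rmorph_prod rmorphB/= rmorph1 comp_Xn_poly exprZn exprVn.
rewrite mulrBr -polyCM mulVf ?expf_neq0// mul_polyC => ->.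
rewrite (eq_bigr (fun u => c^-1 *: ('X - (c * u)%:P))) => [|u _]; last first.
  by rewrite rmorphB/= comp_polyX comp_polyC scalerBr -!mul_polyC -polyCM mulKf.
by rewrite scaler_prod big_const_seq count_predT iter_mulr_1 size_unity_roots// exprVn mul_polyC.
Qed.

Lemma perm_unity_roots k v : (0 < k)%N -> v ^+ k = 1 ->
  perm_eq [seq v * u | u <- unity_roots k] (unity_roots k : seq R[i]).
Proof.
move=> k0 vk; apply: prod_XsubC_eq.
by rewrite -XnsubC_unity_roots// vk -unity_rootsE.
Qed.

Definition cycle_eigenvalues N (z : N.-tuple R[i]) (C : {set 'I_N}) : seq R[i] :=
  [seq croot #|C| (\prod_(i in C) tnth z i) * u | u <- unity_roots #|C|].

(** The k eigenvalues attached to a cycle of length k are indexed by its k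
    points, so that the sets of eigenvalue indices are the subsets of 'I_N. *)
Definition eigenvalue_at N (s : 'S_N) (z : N.-tuple R[i]) (i : 'I_N) : R[i] :=
  (cycle_eigenvalues z (porbit s i))`_(index i (enum (porbit s i))).

Lemma eigenvalue_at_cycle N (s : 'S_N) (z : N.-tuple R[i]) C : C \in porbits s ->
  [seq eigenvalue_at s z i | i <- enum C] = cycle_eigenvalues z C.
Proof.
case/imsetP => i0 _ CE.
have C0 : (0 < #|C|)%N by rewrite CE card_porbit_gt0.
have sz : size (cycle_eigenvalues z C) = size (enum C).
  by rewrite size_map size_unity_roots// -cardE.
apply: (@eq_from_nth _ 0); first by rewrite size_map sz.
move=> n; rewrite size_map => nC; rewrite (nth_map i0)//.
have : nth i0 (enum C) n \in C by rewrite -mem_enum mem_nth.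
move=> iC; have E : porbit s (nth i0 (enum C) n) = C.
  by apply/eqP; rewrite [X in _ == X]CE eq_porbit_mem -CE.
rewrite /eigenvalue_at E.
by rewrite index_uniq// enum_uniq.
Qed.

Lemma trivIset_porbits N (s : 'S_N) : trivIset (porbits s).
Proof.
apply/trivIsetP => _ _ /imsetP[i _ ->] /imsetP[j _ ->]; apply: contraR.
rewrite -setI_eq0 => /set0Pn[k]; rewrite inE -!eq_porbit_mem.
by move=> /andP[/eqP <- /eqP <-].
Qed.

Lemma cover_porbits N (s : 'S_N) : cover (porbits s) = setT.
Proof.
apply/setP => i; rewrite inE; apply/bigcupP; exists (porbit s i).
  exact: imset_f.
exact: porbit_id.
Qed.

Lemma perm_eigenvalues N (s : 'S_N) (z : N.-tuple R[i]) :
  perm_eq (eigenvalues (perm_matrix (s, z)))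
    [seq eigenvalue_at s z i | i <- enum 'I_N].
Proof.
apply: prod_XsubC_eq; have := crootsE (char_poly (perm_matrix (s, z))).
rewrite (monicP (char_poly_monic _)) scale1r => <-.
rewrite char_poly_perm_matrix big_map big_enum /=.
transitivity (\prod_(i in cover (porbits s)) ('X - (eigenvalue_at s z i)%:P)).
  rewrite big_trivIset ?trivIset_porbits//; apply: eq_bigr => C Cs.
  have C0 : (0 < #|C|)%N by case/imsetP: Cs => i _ ->; rewrite card_porbit_gt0.
  rewrite -{1}(croot_expn (\prod_(i in C) tnth z i) C0) XnsubC_unity_roots//.
  by rewrite -/(cycle_eigenvalues z C) -(eigenvalue_at_cycle z Cs) big_map big_enum.
by apply: eq_bigl => i; rewrite cover_porbits inE.
Qed.

End CycleEigenvalues.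

Section PointCorrelationPerm.
Import mathcomp.boot.fintype.
Context {R : realType} {q N : nat} (A : set (q.-tuple R[i])).

Lemma point_correlation_perm (s : 'S_N) (z : N.-tuple R[i]) :
  point_correlation q (perm_matrix (s, z)) A =
  (\sum_(l <- fset_set (Ltilde N q)) (symmetry_factor R l)%:E *
    nested_selection (blocks l) (porbits s) (cycle_eigenvalues z)
      (fun y => (symmetric_indic A y)%:E))%E.
Proof.
rewrite (point_correlationE A (perm_eigenvalues s z)).
rewrite -(sum_over_types (T := 'I_N) _ (trivIset_porbits s) (cover_porbits s)
  (H := fun x => symmetric_indic A [seq eigenvalue_at s z i | i <- x])); last first.
  by move=> x y pxy; apply: perm_symmetric_indic; exact: perm_map.
rewrite card_ord -sumEFin; apply: eq_bigr => l _; rewrite EFinM; congr (_ * _)%E.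
rewrite EFin_nested_sum; apply: perm_nested_selection => C Cs.
by rewrite eigenvalue_at_cycle.
Qed.

End PointCorrelationPerm.

(** * Resampling a block of independent variables *)

Section IteratedIntegrals.
Local Open Scope classical_set_scope.
Local Open Scope ereal_scope.
Context {R : realType}.

Lemma ge0_integral_pushforwardT d1 d2 (X : measurableType d1) (Y : measurableType d2)
    (phi : X -> Y) (mu : {measure set X -> \bar R}) (f : Y -> \bar R) :
  measurable_fun setT phi -> measurable_fun setT f -> (forall y, 0 <= f y) ->
  \int[pushforward mu phi]_y f y = \int[mu]_x f (phi x).
Proof.
by move=> mphi mf f0; rewrite ge0_integral_pushforward.
Qed.

Lemma measurable_integral d1 d2 (X : measurableType d1) (Y : measurableType d2)
    (m : {sigma_finite_measure set Y -> \bar R}) (h : X -> Y -> \bar R) :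
  measurable_fun setT (fun p : X * Y => h p.1 p.2) -> (forall x y, 0 <= h x y) ->
  measurable_fun setT (fun x => \int[m]_y h x y).
Proof.
move=> mh h0.
exact: (measurable_fun_fubini_tonelli_F (fun p : X * Y => h p.1 p.2)).
Qed.

Lemma integral_swap d1 d2 (X : measurableType d1) (Y : measurableType d2)
    (m1 : {sigma_finite_measure set X -> \bar R})
    (m2 : {sigma_finite_measure set Y -> \bar R}) (h : X -> Y -> \bar R) :
  measurable_fun setT (fun p : X * Y => h p.1 p.2) -> (forall x y, 0 <= h x y) ->
  \int[m1]_x \int[m2]_y h x y = \int[m2]_y \int[m1]_x h x y.
Proof.
by move=> mh h0; exact: (fubini_tonelli (fun p : X * Y => h p.1 p.2)).
Qed.

Lemma integral_prob_cst d (X : measurableType d) (P : probability X R) (c : \bar R) :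
  \int[P]_x c = c.
Proof.
by rewrite integral_cst// [X in _ * X](probability_setT P) mule1.
Qed.

Section Iid.
Context {d} {T : measurableType d} (P : probability T R).

Lemma integral_iidS n (f : n.+1.-tuple T -> \bar R) :
  measurable_fun setT f -> (forall t, 0 <= f t) ->
  \int[iid P n.+1]_t f t = \int[P]_x \int[iid P n]_t f (tcons (x, t)).
Proof.
move=> mf f0; rewrite [LHS]ge0_integral_pushforwardT//.
rewrite fubini_tonelli1//.
by apply: measurableT_comp.
Qed.

End Iid.

Lemma measurable_complex_prod d (X : measurableType d) (I : Type) (s : seq I)
    (Q : pred I) (f : I -> X -> R[i]) :
  (forall i, measurable_fun setT (f i)) ->
  measurable_fun setT (fun x => (\prod_(i <- s | Q i) f i x)%R).
Proof.
move=> mf; elim: s => [|i s IHs].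
  by under eq_fun do rewrite big_nil; exact: measurable_cst.
under eq_fun do rewrite big_cons.
by case: (Q i) => //; exact: measurable_complexM.
Qed.

(** The coordinates in Q are independent of the others and enter only
    through their product, so that they may be replaced by a fresh sample.
    The proof splits off the first coordinate; when it lies in Q, any
    other value may stand in its place inside g, and its integral can be
    moved past the others. *)
Lemma integral_iid_block (L : probability R[i] R) N (Q : pred 'I_N)
    (g : N.-tuple R[i] -> R[i] -> \bar R) :
  measurable_fun setT (fun p : N.-tuple R[i] * R[i] => g p.1 p.2) ->
  (forall t w, 0 <= g t w) ->
  (forall t t' w, (forall i, ~~ Q i -> tnth t i = tnth t' i) -> g t w = g t' w) ->
  \int[iid L N]_t g t (\prod_(i | Q i) tnth t i)%R =
  \int[iid L N]_t \int[iid L #|Q|]_u g t (\prod_(i < #|Q|) tnth u i)%R.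
Proof.
have mprodI n (Q0 : pred 'I_n) :
    measurable_fun setT (fun t : n.-tuple R[i] => (\prod_(i | Q0 i) tnth t i)%R).
  by apply: measurable_complex_prod => i; exact: measurable_tnth.
elim: N Q g => [|n IHn] Q g mg g0 gQ.
  have Q0 : #|Q| = 0%N by apply: eq_card0 => -[].
  apply: eq_integral => t _; rewrite big_ord0.
  move: (#|Q|) Q0 => k ->; under eq_integral do rewrite big_ord0.
  by rewrite integral_prob_cst.
pose Q' : pred 'I_n := fun i => Q (lift ord0 i).
have mcons d' (X : measurableType d') (a : X -> R[i]) (b : X -> n.-tuple R[i]) :
    measurable_fun setT a -> measurable_fun setT b ->
    measurable_fun setT (fun x => tcons (a x, b x)).
  by move=> ma mb; exact: measurable_cons.
have mgc d' (X : measurableType d') (a : X -> n.+1.-tuple R[i]) (b : X -> R[i]) :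
    measurable_fun setT a -> measurable_fun setT b ->
    measurable_fun setT (fun x => g (a x) (b x)).
  by move=> ma mb; exact: (measurableT_comp mg (measurable_fun_pair ma mb)).
have mpr k (d' : measure_display) (X : measurableType d') (u : X -> k.-tuple R[i]) :
    measurable_fun setT u -> measurable_fun setT (fun x => (\prod_(i < k) tnth (u x) i)%R).
  by move=> mu; apply: (measurableT_comp (mprodI k predT)).
have prodE (x : R[i]) t : (\prod_(i | Q i) tnth (tcons (x, t)) i =
    (if Q ord0 then x else 1) * \prod_(i | Q' i) tnth t i)%R.
  rewrite big_mkcond big_ord_recl; congr (_ * _)%R.
  by rewrite [RHS]big_mkcond; apply: eq_bigr => i _; rewrite tnthS.
have cardE : #|Q| = (Q ord0 + #|Q'|)%N.
  by rewrite -!sum1_card big_mkcond big_ord_recl [in RHS]big_mkcond.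
rewrite integral_iidS; last 2 first.
- by apply: mgc; [exact: measurable_id|exact: mprodI].
- by move=> t; exact: g0.
under eq_integral => x _ do under eq_integral => t _ do rewrite prodE.
rewrite integral_iidS; last 2 first.
- by apply: measurable_integral => //; apply: mgc => //; apply: mpr.
- by move=> t; apply: integral_ge0.
have gcons x t x' w : Q ord0 -> g (tcons (x, t)) w = g (tcons (x', t)) w.
  move=> Q0; apply: gQ => i; case: (unliftP ord0 i) => [j|] ->.
    by rewrite !tnthS.
  by rewrite Q0.
have gtail x t t' w : (forall i, ~~ Q' i -> tnth t i = tnth t' i) ->
    g (tcons (x, t)) w = g (tcons (x, t')) w.
  move=> tt'; apply: gQ => i; case: (unliftP ord0 i) => [j|] -> Qj.
    by rewrite !tnthS; apply: tt'.
  by rewrite !tnth0.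
case Q0 : (Q ord0) cardE => /= cardE; last first.
  rewrite cardE; apply: eq_integral => x _.
  under eq_integral do rewrite mul1r.
  rewrite (IHn Q' (fun t w => g (tcons (x, t)) w))//.
    apply: mgc; last exact: measurable_snd.
    by apply: mcons => //; exact: measurable_fst.
  by move=> t t' w; exact: gtail.
rewrite cardE.
under eq_integral => x _.
  rewrite (IHn Q' (fun t w => g (tcons (x, t)) (x * w)%R))//; last 2 first.
  - apply: mgc; first by apply: mcons => //; exact: measurable_fst.
    by apply: measurable_complexM => //; exact: measurable_snd.
  - by move=> t t' w; exact: gtail.
  over.
pose h x t := \int[iid L #|Q'|]_u g (tcons (x, t)) (x * \prod_(i < #|Q'|) tnth u i)%R.
have mh : measurable_fun setT (fun p : R[i] * n.-tuple R[i] => h p.1 p.2).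
  apply: measurable_integral => //; apply: mgc.
    by apply: mcons; apply: measurableT_comp.
  apply: measurable_complexM; first by apply: measurableT_comp.
  exact: mpr.
have h0 x t : 0 <= h x t by apply: integral_ge0.
transitivity (\int[L]_x' \int[iid L n]_t \int[L]_x h x t); last first.
  apply: eq_integral => x' _; apply: eq_integral => t _.
  rewrite integral_iidS; last 2 first.
  - by apply: mgc; [exact: measurable_cst|apply: mpr; exact: measurable_id].
  - by move=> u; exact: g0.
  apply: eq_integral => x _; apply: eq_integral => u _.
  rewrite (gcons x t x')//; congr (g _ _).
  by rewrite big_ord_recl; congr (_ * _)%R; apply: eq_bigr => i _; rewrite tnthS.
by rewrite integral_prob_cst integral_swap.
Qed.

End IteratedIntegrals.

(** * The laws of the roots attached to a cycle *)

Section SeqMeasurable.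
Local Open Scope classical_set_scope.
Local Open Scope ereal_scope.
Context {R : realType}.

(** Working with words of any length avoids casts between the tuple types over
    which the tensor product is built; measurability is then required length by
    length. *)
Definition seq_measurable d (X : measurableType d) (F : X -> seq R[i] -> \bar R) :=
  forall n, measurable_fun setT (fun p : X * n.-tuple R[i] => F p.1 p.2).

Lemma seq_measurable_comp d (X : measurableType d) (F : X -> seq R[i] -> \bar R)
    d' (Y : measurableType d') (a : Y -> X) n (b : Y -> n.-tuple R[i]) :
  seq_measurable F -> measurable_fun setT a -> measurable_fun setT b ->
  measurable_fun setT (fun y => F (a y) (b y)).
Proof.
by move=> mF ma mb; exact: (measurableT_comp (mF n) (measurable_fun_pair ma mb)).
Qed.

Lemma selection_sum_ge0 (V : eqType) r (s : seq V) (f : seq V -> \bar R) :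
  (forall y, 0 <= f y) -> 0 <= selection_sum r s f.
Proof.
elim: r s f => [|r IHr] s f f0 /=; first exact: f0.
by apply: sume_ge0 => v _; apply: IHr.
Qed.

Lemma measurable_scaled_tuple d (X : measurableType d) n (c : X -> R[i])
    (u : n.-tuple R[i]) : measurable_fun setT c ->
  measurable_fun setT (fun x => [tuple of [seq c x * v | v <- u]]%R).
Proof.
move=> mc; apply/measurable_fun_tnthP => i.
rewrite (_ : _ \o _ = fun x => (c x * tnth u i)%R).
  by apply: measurable_complexM => //; exact: measurable_cst.
by apply/funext => x /=; rewrite tnth_map.
Qed.

Lemma selection_sum_scaled r (c : R[i]) (s : seq R[i]) (f : seq R[i] -> \bar R) :
  selection_sum r [seq c * v | v <- s]%R f =
  \sum_(j : r.-tuple 'I_(size s) | uniq j)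
     f [tuple of [seq c * v | v <- [tuple of [seq s`_i | i : 'I_(size s) <- j]]]]%R.
Proof.
have -> : [seq c * v | v <- s]%R = [seq (c * s`_i)%R | i : 'I_(size s) <- enum predT].
  rewrite -[in LHS](mkseq_nth 0%R s) /mkseq -val_enum_ord -!map_comp.
  exact: eq_map.
rewrite -(sum_uniq_tuples r predT (fun i : 'I_(size s) => (c * s`_i)%R)).
apply: eq_big => [j|j _]; first by rewrite all_predT andbT.
by congr f; rewrite /= -map_comp.
Qed.

Lemma measurable_selection_sum d (X : measurableType d) r (c : X -> R[i])
    (s : seq R[i]) (F : X -> seq R[i] -> \bar R) :
  measurable_fun setT c -> seq_measurable F ->
  measurable_fun setT (fun x => selection_sum r [seq c x * v | v <- s]%R (F x)).
Proof.
move=> mc mF; under eq_fun do rewrite selection_sum_scaled big_mkcond/=.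
apply: emeasurable_sum => j; case: (uniq j) => //.
apply: (seq_measurable_comp mF) => //.
exact: measurable_scaled_tuple.
Qed.

End SeqMeasurable.

Section FiniteMixtures.
Local Open Scope classical_set_scope.
Local Open Scope ereal_scope.
Context {d} {T : measurableType d} {R : realType}.

Lemma ge0_integral_mfsum (I : finType) (P : pred I)
    (m : I -> {measure set T -> \bar R}) (f : T -> \bar R) :
  measurable_fun setT f -> (forall x, 0 <= f x) ->
  \int[mfsum P m]_x f x = \sum_(i | P i) \int[m i]_x f x.
Proof.
move=> mf f0.
pose s : seq {measure set T -> \bar R} := [seq m i | i <- enum P].
pose m_ n : {measure set T -> \bar R} := nth (mzero : {measure set T -> \bar R}) s n.
rewrite (@eq_measure_integral _ _ _ setT (msum m_ (size s))); last first.
  move=> B _ _; rewrite /mfsum /msum /= -[LHS]big_enum/=.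
  by rewrite -(big_map m xpredT (fun mu : {measure set T -> \bar R} => mu B)) -/s
    (big_nth (mzero : {measure set T -> \bar R})) big_mkord.
rewrite ge0_integral_measure_sum// -[RHS]big_enum/=.
rewrite -(big_map m xpredT (fun mu : {measure set T -> \bar R} => \int[mu]_x f x)).
by rewrite -/s (big_nth (mzero : {measure set T -> \bar R})) big_mkord.
Qed.

Lemma mnormalizeE (mu : {measure set T -> \bar R}) (P : probability T R) (c : R) A :
  (0 < c)%R -> mu setT = c%:E -> mnormalize mu P A = mu A * c^-1%:E.
Proof. by move=> c0 muT; rewrite /mnormalize muT eqe gt_eqF. Qed.

Lemma ge0_integral_mnormalize (mu : {measure set T -> \bar R}) (P : probability T R)
    (c : R) (f : T -> \bar R) : (0 < c)%R -> mu setT = c%:E ->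
  measurable_fun setT f -> (forall x, 0 <= f x) ->
  \int[mnormalize mu P]_x f x = c^-1%:E * \int[mu]_x f x.
Proof.
move=> c0 muT mf f0; have c0' : (0 <= c^-1)%R by rewrite invr_ge0 ltW.
rewrite [LHS](@eq_measure_integral _ _ _ setT (mscale (NngNum c0') mu)); last first.
  move=> B _ _; rewrite [LHS](mnormalizeE _ _ c0 muT).
  by rewrite muleC.
by rewrite ge0_integral_mscale.
Qed.

End FiniteMixtures.

Lemma sum_seq_const (R : realType) (I : Type) (s : seq I) (c : \bar R) :
  (\sum_(i <- s) c = (size s)%:R%:E * c)%E.
Proof.
rewrite mule_natl big_const_seq count_predT; elim: (size s) => [|n IHn].
  by rewrite mule0n.
by rewrite iterS IHn muleS.
Qed.

Section RootLaw.
Local Open Scope classical_set_scope.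
Local Open Scope ereal_scope.
Context {R : realType} (L : probability R[i] R) (hL : L [set 0%R] = 0).

Lemma measurable_complex_set0 : measurable [set 0%R : R[i]].
Proof.
have [mRe mIm] : measurable_fun setT (@complex.Re R) /\ measurable_fun setT (@complex.Im R).
  by apply/(@measurable_complexP R _ _ id); exact: measurable_id.
rewrite (_ : [set _] = (@complex.Re R) @^-1` [set 0%R] `&` (@complex.Im R) @^-1` [set 0%R]).
  by apply: measurableI; rewrite -[X in measurable X]setTI; [apply: mRe|apply: mIm].
apply/seteqP; split=> [_ ->//|[x y] /= [-> ->]//].
Qed.

Lemma measurable_tuple_prod k :
  measurable_fun setT (fun t : k.-tuple R[i] => (\prod_(i < k) tnth t i)%R).
Proof. by apply: measurable_complex_prod => i; exact: measurable_tnth. Qed.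

Lemma iid_prod_eq0 k :
  iid L k [set t | (\prod_(i < k) tnth t i)%R = 0%R] = 0.
Proof.
pose Z n := [set t : n.-tuple R[i] | (\prod_(i < n) tnth t i)%R = 0%R].
have mZ n : measurable (Z n).
  have := measurable_tuple_prod (k := n) measurableT measurable_complex_set0.
  by rewrite setTI.
elim: k => [|k IHk].
  rewrite (_ : [set t | _] = set0) ?measure0//.
  by apply/seteqP; split=> // t /=; rewrite big_ord0 => /eqP; rewrite oner_eq0.
have massE n : iid L n (Z n) = \int[iid L n]_t (\1_(Z n) t)%:E.
  by rewrite integral_indic// ?setIT//; exact: mZ.
rewrite [LHS]massE integral_iidS; last 2 first.
- by apply/measurable_EFinP; apply: measurable_indic; exact: mZ.
- by move=> t; rewrite lee_fin indicE.
rewrite (eq_integral (fun x : R[i] => (\1_[set 0%R] x)%:E)); last first.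
  move=> x _; have E (t : k.-tuple R[i]) : (\prod_(i < k.+1) tnth (tcons (x, t)) i =
      x * \prod_(i < k) tnth t i)%R.
    by rewrite big_ord_recl; congr (_ * _)%R; apply: eq_bigr => i _; rewrite tnthS.
  have [x0|x0] := eqVneq x 0%R.
    rewrite (eq_integral (fun=> 1)); last first.
      by move=> t _; rewrite indicE mem_set// /Z /= E x0 mul0r.
    by rewrite integral_prob_cst indicE mem_set.
  rewrite [RHS](_ : _ = 0); last first.
    by rewrite indicE memNset//; apply/eqP.
  rewrite -IHk [RHS]massE.
  apply: eq_integral => t _; rewrite !indicE; congr (_%:R%:E); congr nat_of_bool.
  apply/idP/idP => /set_mem; rewrite /Z /= => h; apply/mem_set => /=.
    by move/eqP: h; rewrite E mulf_eq0 (negbTE x0) => /eqP.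
  by rewrite E h mulr0.
by rewrite integral_indic ?setIT//; exact: measurable_complex_set0.
Qed.

Section Existence.
Variables (k : nat) (k0 : (0 < k)%N).

Let rotated (v : R[i]) (t : k.-tuple R[i]) : R[i] :=
  (v * croot k (\prod_(i < k) tnth t i))%R.

Let measurable_rotated v : measurable_fun setT (rotated v).
Proof.
apply: measurable_complexM; first exact: measurable_cst.
by apply: (measurableT_comp (measurable_croot k)); exact: measurable_tuple_prod.
Qed.

Let rotated_mfun v : {mfun k.-tuple R[i] >-> R[i]} := mfun_Sub (mem_set (@measurable_rotated v)).

Let mixture := mfsum xpredT
  (fun j : 'I_k => image_measure (rotated_mfun (unity_roots k)`_j) (iid L k)).

Let mixtureE A : mixture A = \sum_(v <- unity_roots k) iid L k (rotated v @^-1` A).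
Proof.
by rewrite (big_nth 0%R) size_unity_roots// big_mkord.
Qed.

Let mixtureT : mixture setT = k%:R%:E.
Proof.
rewrite mixtureE (eq_bigr (fun=> 1)) => [|v _]; last first.
  by rewrite preimage_setT probability_setT.
by rewrite sum_seq_const size_unity_roots// mule1.
Qed.

Let averaged : probability R[i] R := mnormalize mixture \d_(0%R : R[i]).

Let averagedE A : averaged A =
  (\sum_(v <- unity_roots k) iid L k (rotated v @^-1` A)) * (k%:R^-1)%:E.
Proof.
rewrite -mixtureE; apply: mnormalizeE; last exact: mixtureT.
by rewrite ltr0n.
Qed.

(** The average, over the k-th roots of unity v, of the laws of v times a k-th
    root of the product of the sample. *)
Lemma is_root_law_exists : exists P, is_root_law L k P.
Proof.
have k0' : k%:R != 0%R :> R by rewrite pnatr_eq0 -lt0n.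
have root_unit (v : R[i]) : v \in unity_roots k -> (v ^+ k = 1)%R.
  by rewrite Defs.mem_unity_roots// => /eqP.
exists averaged; split.
- rewrite averagedE big_seq big1 ?mul0e// => v /root_unit vk.
  rewrite -(iid_prod_eq0 k); congr (iid L k _); apply/seteqP; split => t /=.
    move=> /(congr1 (fun z => z ^+ k)%R).
    by rewrite exprMn vk mul1r croot_expn// expr0n gtn_eqF.
  rewrite /rotated => ->; have /eqP := croot_expn (0%R : R[i]) k0.
  by rewrite expf_eq0 k0 => /= /eqP ->; rewrite mulr0.
- move=> u uk A mA; rewrite /pushforward !averagedE; congr (_ * _).
  rewrite -[RHS](perm_big _ (perm_unity_roots k0 uk)) big_map.
  apply: eq_bigr => v _; congr (iid L k _); apply/seteqP.
  by split=> t /=; rewrite /rotated mulrA.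
- move=> A mA; rewrite {1}/pushforward averagedE big_seq.
  rewrite (eq_bigr (fun=> pushforward (iid L k)
      (fun t => \prod_(i < k) tnth t i)%R A)) => [|v /root_unit vk].
    by rewrite -big_seq sum_seq_const size_unity_roots// muleAC -EFinM divff// mul1e.
  congr (iid L k _); apply/seteqP.
  by split=> t /=; rewrite /rotated exprMn vk mul1r croot_expn.
Qed.

Lemma root_lawP : is_root_law L k (root_law L k).
Proof. exact: getPex is_root_law_exists. Qed.

(** The integrand is invariant under the k-th roots of unity, hence a function
    of z ^+ k, and the law of z ^+ k is that of the product of the sample. *)
Lemma integral_root_law r (f : seq R[i] -> \bar R) :
  measurable_fun setT (fun y : r.-tuple R[i] => f y) -> (forall y, 0 <= f y) ->
  \int[root_law L k]_z selection_sum r [seq z * v | v <- unity_roots k]%R f =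
  \int[iid L k]_t selection_sum r
    [seq croot k (\prod_(i < k) tnth t i) * v | v <- unity_roots k]%R f.
Proof.
move=> mf f0.
pose G (z : R[i]) := selection_sum r [seq z * v | v <- unity_roots k]%R f.
have mG : measurable_fun setT G.
  rewrite /G; under eq_fun do rewrite selection_sum_scaled big_mkcond/=.
  apply: emeasurable_sum => j; case: (uniq j) => //.
  by apply: (measurableT_comp mf); apply: measurable_scaled_tuple.
have G0 z : 0 <= G z by apply: selection_sum_ge0.
have Gk z : G (croot k (z ^+ k)%R) = G z.
  apply: perm_selection_sum; have E := croot_expn (z ^+ k)%R k0.
  have [z0|z0] := eqVneq z 0%R.
    move: E; rewrite z0 expr0n gtn_eqF// => /eqP.
    by rewrite expf_eq0 k0 => /= /eqP ->.
  have /(perm_unity_roots k0) pz : ((croot k (z ^+ k) / z) ^+ k = 1)%R.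
    by rewrite expr_div_n E divff// expf_neq0.
  rewrite -(permPr (perm_map _ pz)) -map_comp.
  rewrite (eq_map (g := fun v => croot k (z ^+ k) * v)%R)// => v /=.
  by rewrite mulrA mulrCA divff// mulr1.
have mcG : measurable_fun setT (G \o croot k).
  exact: (measurableT_comp mG (measurable_croot k)).
have mpow : measurable_fun setT (fun z : R[i] => z ^+ k)%R.
  rewrite (_ : (fun _ => _) = fun z : R[i] => (\prod_(i < k) z)%R); last first.
    by apply/funext => z; rewrite prodr_const card_ord.
  by apply: measurable_complex_prod => i; exact: measurable_id.
transitivity (\int[pushforward (root_law L k) (fun z : R[i] => z ^+ k)%R]_w (G \o croot k) w).
  rewrite ge0_integral_pushforwardT//; last by move=> y; exact: G0.
  by apply: eq_integral => z _ /=; rewrite Gk.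
rewrite (eq_measure_integral (pushforward (iid L k) (fun t => \prod_(i < k) tnth t i)%R)).
- exact: measurable_tuple_prod.
- by move=> mp; rewrite ge0_integral_pushforwardT// => y; exact: G0.
- by move=> mp A mA _; have [_ _] := root_lawP; apply.
Qed.

Lemma integral_root_correlation r (f : seq R[i] -> \bar R) :
  measurable_fun setT (fun y : r.-tuple R[i] => f y) -> (forall y, 0 <= f y) ->
  \int[root_correlation L k r]_y f y =
  \int[iid L k]_t selection_sum r
    [seq croot k (\prod_(i < k) tnth t i) * v | v <- unity_roots k]%R f.
Proof.
move=> mf f0; rewrite -integral_root_law//.
pose I := seq_sub (unity_roots k : seq R[i]).
rewrite [LHS]ge0_integral_mfsum//.
have mscaled (u : r.-tuple R[i]) : measurable_fun setT (fun z : R[i] => f (multiples u z)).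
  exact: (measurableT_comp mf).
transitivity (\sum_(u : r.-tuple I | uniq u)
    \int[root_law L k]_z f (multiples [tuple of map val u] z)).
  by apply: eq_bigr => u _; rewrite [LHS]ge0_integral_pushforwardT.
rewrite -big_filter -ge0_integral_sum//.
apply: eq_integral => z _; rewrite big_filter.
transitivity (\sum_(u : r.-tuple I | uniq u && all predT u) f [seq z * val i | i <- u]%R).
  apply: eq_big => [u|u _]; first by rewrite all_predT andbT.
  rewrite (_ : multiples _ z = [tuple of [seq z * v | v <- [tuple of map val u]]]%R).
    by rewrite /= -map_comp.
  by apply: eq_from_tnth => i; rewrite tnth_mktuple !tnth_map.
rewrite (sum_uniq_tuples r predT (fun i : I => z * val i)%R).
apply: perm_selection_sum.
rewrite (map_comp (fun v => z * v)%R val); apply: perm_map.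
apply: uniq_perm.
- by rewrite (map_inj_uniq val_inj) enum_uniq.
- exact: uniq_unity_roots.
- move=> v; apply/mapP/idP => [[i _ ->]|vU]; first exact: valP.
  by exists (SeqSub vU); rewrite ?mem_enum.
Qed.

End Existence.
End RootLaw.

(** * Expectation for a fixed permutation *)

Section TensorIntegrals.
Local Open Scope classical_set_scope.
Local Open Scope ereal_scope.
Context {R : realType} (L : probability R[i] R) (hL : L [set 0%R] = 0).

Lemma integral_tensor_nil (f : seq R[i] -> \bar R) :
  measurable_fun setT (fun y : 0.-tuple R[i] => f y) ->
  \int[tensor L [::]]_y f y = f [::].
Proof. by move=> mf; rewrite [LHS]integral_dirac// diracT mul1e. Qed.

Lemma integral_tensor_cons k r B (f : seq R[i] -> \bar R) :
  (forall n, measurable_fun setT (fun y : n.-tuple R[i] => f y)) ->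
  (forall y, 0 <= f y) ->
  \int[tensor L ((k, r) :: B)]_y f y =
  \int[root_correlation L k r]_y \int[tensor L B]_y' f (y ++ y').
Proof.
move=> mf f0; rewrite [LHS]ge0_integral_pushforwardT//; last exact: mf.
have mf' := mf (r + sumn (unzip2 B))%N.
rewrite [LHS]fubini_tonelli1//.
exact: (measurableT_comp mf' (measurable_funPT (@tcat R r (sumn (unzip2 B))))).
Qed.

Lemma seq_measurable_catl d (X : measurableType d) (F : X -> seq R[i] -> \bar R)
    n (w : X -> n.-tuple R[i]) :
  seq_measurable F -> measurable_fun setT w ->
  seq_measurable (fun x y => F x (w x ++ y)).
Proof.
move=> mF mw m.
apply: (seq_measurable_comp (b := fun p : X * m.-tuple R[i] => tcat (w p.1, p.2)) mF).
  exact: measurable_fst.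
apply: (measurableT_comp (measurable_funPT (@tcat R n m))).
apply: measurable_fun_pair; last exact: measurable_snd.
exact: (measurableT_comp mw measurable_fst).
Qed.

Lemma nested_selection_ge0 (T : finType) (V : eqType) B Z (blk : {set T} -> seq V)
    (f : seq V -> \bar R) : (forall y, 0 <= f y) -> 0 <= nested_selection B Z blk f.
Proof.
elim: B Z f => [|[k r] B IHB] Z f f0 /=; first exact: f0.
by apply: sume_ge0 => C _; apply: selection_sum_ge0 => y; apply: IHB.
Qed.

Section Nested.
Variable N : nat.
Implicit Types (B : seq (nat * nat)) (Z : {set {set 'I_N}}) (C : {set 'I_N}).
Implicit Types (F : N.-tuple R[i] -> seq R[i] -> \bar R).

Let cycle_root C (z : N.-tuple R[i]) : R[i] := croot #|C| (\prod_(i in C) tnth z i)%R.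

Let picked C r (j : r.-tuple 'I_(size (unity_roots #|C| : seq R[i])))
    (z : N.-tuple R[i]) : r.-tuple R[i] :=
  [tuple of [seq (cycle_root C z * v)%R
            | v <- [tuple of [seq (unity_roots #|C|)`_i | i : 'I_(size (unity_roots #|C|)) <- j]]]].

Let measurable_cycle_root C : measurable_fun setT (cycle_root C).
Proof.
apply: (measurableT_comp (measurable_croot _)).
by apply: measurable_complex_prod => i; exact: measurable_tnth.
Qed.

Let measurable_picked C r (j : r.-tuple 'I_(size (unity_roots #|C| : seq R[i]))) :
  measurable_fun setT (picked j).
Proof. exact: measurable_scaled_tuple. Qed.

Let nested_cons k r B Z (z : N.-tuple R[i]) (f : seq R[i] -> \bar R) :
  nested_selection ((k, r) :: B) Z (cycle_eigenvalues z) f =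
  \sum_(C in Z | #|C| == k)
    \sum_(j : r.-tuple 'I_(size (unity_roots #|C| : seq R[i])) | uniq j)
      nested_selection B (Z :\ C) (cycle_eigenvalues z) (fun y => f (picked j z ++ y)).
Proof. by apply: eq_bigr => C _; rewrite [LHS]selection_sum_scaled. Qed.

Lemma measurable_nested_selection B Z F : seq_measurable F ->
  measurable_fun setT (fun z => nested_selection B Z (cycle_eigenvalues z) (F z)).
Proof.
elim: B Z F => [|[k r] B IHB] Z F mF.
  exact: (seq_measurable_comp (b := fun _ => [tuple]) mF).
under eq_fun do rewrite nested_cons big_mkcond/=.
apply: emeasurable_sum => C; case: (_ && _) => /=; last exact: measurable_cst.
under eq_fun do rewrite big_mkcond/=.
apply: emeasurable_sum => j; case: (uniq j) => /=; last exact: measurable_cst.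
exact: IHB (seq_measurable_catl mF (measurable_picked j)).
Qed.

(** Given the other coordinates, the product over the first chosen cycle can be
    resampled, and this produces the correlation measure of its length. The
    outcome does not depend on the cycles chosen, so that only their number
    remains. The dependence of F on the coordinates off Z carries the cycles
    already chosen through the induction. *)
Lemma integral_nested_selection B Z F :
  all (fun v => 0 < v.1)%N B -> finset.trivIset Z ->
  seq_measurable F -> (forall z y, 0 <= F z y) ->
  (forall z z' y, (forall i, i \notin finset.cover Z -> tnth z i = tnth z' i) ->
     F z y = F z' y) ->
  \int[iid L N]_z nested_selection B Z (cycle_eigenvalues z) (F z) =
  (count_blocks R (unzip1 B) Z)%:E *
    \int[iid L N]_z \int[tensor L B]_y F z y.
Proof.
elim: B Z F => [|[k r] B IHB] Z F.
  move=> _ _ mF _ _; rewrite mul1e; apply: eq_integral => z _.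
  rewrite integral_tensor_nil//.
  exact: (seq_measurable_comp (a := fun=> z) mF).
move=> Bpos' tZ mF F0 FZ; have /andP[/= k0 Bpos] := Bpos'.
have mFz z n : measurable_fun setT (fun y : n.-tuple R[i] => F z y).
  exact: (seq_measurable_comp (a := fun=> z) mF).
rewrite [LHS](eq_integral _ _ (fun z _ => nested_cons k r B Z z (F z))).
under [LHS]eq_integral do rewrite -big_filter.
rewrite [LHS]ge0_integral_sum//; last 2 first.
- move=> C; under eq_fun do rewrite big_mkcond/=.
  apply: emeasurable_sum => j; case: (uniq j) => /=; last exact: measurable_cst.
  by apply: measurable_nested_selection; exact: (seq_measurable_catl mF (measurable_picked j)).
- by move=> C z _; apply: sume_ge0 => j _; apply: nested_selection_ge0.
rewrite big_filter -sumEFin ge0_sume_distrl; last first.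
  by move=> C _; rewrite lee_fin; exact: count_blocks_ge0.
apply: eq_bigr => C /andP[CZ /eqP kC].
have CD := disjoint_cover_D1 tZ CZ.
have tZC := trivIset_D1 C tZ.
have cZ := cover_D1 tZ CZ.
under [LHS]eq_integral do rewrite -big_filter.
rewrite [LHS]ge0_integral_sum//; last 2 first.
- by move=> j; apply: measurable_nested_selection; exact: (seq_measurable_catl mF (measurable_picked j)).
- by move=> j z _; apply: nested_selection_ge0.
rewrite big_filter.
rewrite (eq_bigr (fun j => (count_blocks R (unzip1 B) (finset.setD Z [set C]%SET))%:E *
    \int[iid L N]_z \int[tensor L B]_y F z (picked j z ++ y))); last first.
  move=> j _; apply: (IHB _ (fun z y => F z (picked j z ++ y)) Bpos tZC).
  - exact: (seq_measurable_catl mF (measurable_picked j)).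
  - by move=> z y; exact: F0.
  move=> z z' y zz'.
  have -> : picked j z = picked j z'.
    rewrite /picked /cycle_root (eq_bigr (tnth z'))// => i iC.
    by apply: zz'; rewrite (disjointFr CD iC).
  by apply: FZ => i; rewrite cZ finset.inE negb_or => /andP[_]; exact: zz'.
rewrite -ge0_sume_distrr; last first.
  by move=> j _; apply: integral_ge0 => z _; apply: integral_ge0.
congr (_ * _).
have mI j : measurable_fun setT (fun z => \int[tensor L B]_y F z (picked j z ++ y)).
  apply: measurable_integral => //.
  by have := seq_measurable_catl mF (measurable_picked j); apply.
rewrite -big_filter -ge0_integral_sum//; last first.
  by move=> j z _; apply: integral_ge0.
pose G (z : N.-tuple R[i]) (w : R[i]) := selection_sum r [seq croot k w * v | v <- unity_roots k]%R
  (fun y => \int[tensor L B]_y' F z (y ++ y')).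
transitivity (\int[iid L N]_z G z (\prod_(i in C) tnth z i)%R).
  apply: eq_integral => z _; rewrite big_filter /G -kC.
  by rewrite selection_sum_scaled.
have mInt : seq_measurable (fun (p : N.-tuple R[i] * R[i]) y =>
    \int[tensor L B]_y' F p.1 (y ++ y')).
  move=> n; apply: measurable_integral => //.
  apply: (seq_measurable_comp (b := fun p : N.-tuple R[i] * R[i] * n.-tuple R[i] * _ => tcat (p.1.2, p.2)) mF).
    by apply: measurableT_comp => //; apply: measurableT_comp.
  apply: (measurableT_comp (measurable_funPT (@tcat R n _))).
  by apply: measurable_fun_pair => //; apply: measurableT_comp.
rewrite (integral_iid_block L (Q := [in C]) (g := G)).
- apply: eq_integral => z _; rewrite integral_tensor_cons//.
  rewrite (integral_root_correlation hL k0 (f := fun y => \int[tensor L B]_y' F z (y ++ y')))//; last 2 first.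
  + exact: (measurable_fun_pair2 (z, 0%R : R[i]) (mInt r)).
  + by move=> y; apply: integral_ge0.
  have -> : #|[in C]| = k by rewrite -kC; apply: eq_card.
  by [].
- apply: measurable_selection_sum => //.
  exact: (measurableT_comp (measurable_croot k) measurable_snd).
- by move=> z w; apply: selection_sum_ge0 => y; apply: integral_ge0.
- move=> z z' w zz'; apply: eq_selection_sum => y; apply: eq_integral => y' _.
  apply: FZ => i; rewrite cZ finset.inE negb_or => /andP[iC _]; exact: zz'.
Qed.

End Nested.
End TensorIntegrals.

(** * The law of the random matrix *)

Section MatrixLaw.
Import HBNNSimple.
Local Open Scope classical_set_scope.
Local Open Scope ereal_scope.
Context {R : realType}.

(** Off D nothing is known on f, so that its integral is a supremum over the
    simple functions below f. Composing these with phi gives one inequality,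
    and the restriction of f to D gives the other. *)
Lemma integral_pushforward_on d1 d2 (X : measurableType d1) (Y : measurableType d2)
    (mu : {measure set X -> \bar R}) (phi : X -> Y) (D : set Y) (f : Y -> \bar R) :
  measurable_fun setT phi -> measurable D -> (forall x, D (phi x)) ->
  (forall y, 0 <= f y) -> measurable_fun D f ->
  \int[pushforward mu phi]_y f y = \int[mu]_x f (phi x).
Proof.
move=> mphi mD phiD f0 mf; pose g := f \_ D.
have mg : measurable_fun setT g by apply/(measurable_restrictT _ mD).
have g0 y : 0 <= g y by rewrite /g patchE; case: ifP.
have gphi x : g (phi x) = f (phi x) by rewrite /g patchE mem_set.
have gf y : g y <= f y by rewrite /g patchE; case: ifP.
have -> : \int[mu]_x f (phi x) = \int[pushforward mu phi]_y g y.
  by rewrite ge0_integral_pushforwardT//; apply: eq_integral => x _; rewrite gphi.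
apply/eqP; rewrite eq_le; apply/andP; split; rewrite [X in X <= _]ge0_integralTE//.
  apply: ge_ereal_sup => _ [h /= hf <-]; rewrite -integralT_nnsfun.
  have mh : measurable_fun setT (fun y : Y => (h y)%:E) by exact/measurable_EFinP.
  have h0 (y : Y) : 0 <= (h y)%:E by rewrite lee_fin.
  rewrite (ge0_integral_pushforwardT _ mphi mh h0).
  rewrite (ge0_integral_pushforwardT _ mphi mg g0).
  apply: ge0_le_integral.
  - exact: measurableT.
  - by move=> x _; exact: h0.
  - exact: (measurableT_comp mh mphi).
  - exact: (measurableT_comp mg mphi).
  - by move=> x _; rewrite gphi; exact: hf.
rewrite [X in _ <= X]ge0_integralTE//; apply: le_ereal_sup => _ [h /= hg <-].
by exists h => // x; exact: le_trans (hg x) (gf x).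
Qed.

Lemma measurable_entry N (j k : 'I_N) :
  measurable_fun setT (fun M : 'M[R[i]]_N => M j k).
Proof.
move=> _ B mB; rewrite setTI; apply: sub_sigma_algebra.
by exists j, k, B.
Qed.

Definition perm_supported N (s : 'S_N) : set 'M[R[i]]_N :=
  [set M | forall j k, j != s k -> M j k = 0%R].

Lemma measurable_perm_supported N (s : 'S_N) : measurable (perm_supported s).
Proof.
rewrite (_ : perm_supported s = \bigcap_(p in [set: 'I_N * 'I_N])
    [set M : 'M[R[i]]_N | p.1 != s p.2 -> M p.1 p.2 = 0%R]).
  apply: fin_bigcap_measurable; first exact: finite_finset.
  move=> [j k] _ /=; have [_|jk] := eqVneq j (s k).
    by rewrite (_ : [set _ | _] = setT)//; apply/seteqP; split.
  rewrite (_ : [set _ | _] = (fun M : 'M[R[i]]_N => M j k) @^-1` [set 0%R]).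
    by rewrite -[X in measurable X]setTI; apply: measurable_entry => //; exact: measurable_complex_set0.
  by apply/seteqP; split => M /=; [apply|move=> ->].
by apply/seteqP; split=> M /= H; [move=> [j k] _; exact: H|move=> j k; exact: (H (j, k))].
Qed.

Lemma perm_supported_perm_matrix N (s : 'S_N) (z : N.-tuple R[i]) :
  perm_supported s (perm_matrix (s, z)).
Proof. by move=> j k /negbTE jk; rewrite mxE jk mulr0. Qed.

Lemma perm_supportedE N (s : 'S_N) (M : 'M[R[i]]_N) : perm_supported s M ->
  M = perm_matrix (s, [tuple M j (s^-1%g j) | j < N]).
Proof.
move=> sM; apply/matrixP => j k; rewrite mxE tnth_mktuple.
have [->|jk] := eqVneq j (s k); first by rewrite permK mulr1.
by rewrite mulr0 sM.
Qed.

Section Correlation.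
Variables (N q : nat) (L : probability R[i] R) (hL : L [set 0%R] = 0).
Variables (A : set (q.-tuple R[i])) (mA : measurable A).

Let f (M : 'M[R[i]]_N) := point_correlation q M A.
Let D := \bigcup_(s in [set: 'S_N]) perm_supported s.

Lemma measurable_nth_tuple m n :
  measurable_fun setT (fun y : m.-tuple R[i] => (tval y)`_n).
Proof.
have [nm|mn] := ltnP n m.
  rewrite (_ : (fun _ => _) = (fun y : m.-tuple R[i] => tnth y (Ordinal nm))).
    exact: measurable_tnth.
  by apply/funext => y; rewrite (tnth_nth 0%R).
rewrite (_ : (fun _ => _) = cst 0%R); first exact: measurable_cst.
by apply/funext => y; rewrite nth_default// size_tuple.
Qed.

Lemma measurable_permute m (s : 'S_q) :
  measurable_fun setT (fun y : m.-tuple R[i] => permute s y).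
Proof.
apply/measurable_fun_tnthP => i.
rewrite (_ : _ \o _ = fun y : m.-tuple R[i] => (tval y)`_(s i)).
  exact: measurable_nth_tuple.
by apply/funext => y /=; rewrite tnth_mktuple.
Qed.

Lemma measurable_symmetric_indic m :
  measurable_fun setT (fun y : m.-tuple R[i] => (symmetric_indic A y)%:E).
Proof.
apply/measurable_EFinP; rewrite /symmetric_indic.
under eq_fun do rewrite size_tuple.
case: (m == q); last exact: measurable_cst.
apply: measurable_sum => s.
apply: (measurableT_comp (measurable_indic mA)); exact: measurable_permute.
Qed.

Lemma symmetric_indic_ge0 y : (0 <= symmetric_indic A y)%R.
Proof.
rewrite /symmetric_indic; case: ifP => // _.
by apply: sumr_ge0 => s _; rewrite indicE.
Qed.

Lemma integral_tensor_symmetric_indic l : Ltilde N q l ->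
  \int[tensor L (blocks l)]_y (symmetric_indic A y)%:E =
  \sum_(s : 'S_q) pushforward (tensor L (blocks l)) (permute s) A.
Proof.
move=> Ll; have mp s := measurable_permute (m := sumn (unzip2 (blocks l))) s.
have mpA s : measurable ((fun y : (sumn (unzip2 (blocks l))).-tuple R[i] => permute s y) @^-1` A).
  by rewrite -[X in measurable X]setTI; apply: mp.
transitivity (\int[tensor L (blocks l)]_y \sum_(s : 'S_q)
    (\1_((fun y : (sumn (unzip2 (blocks l))).-tuple R[i] => permute s y) @^-1` A) y)%:E).
  apply: eq_integral => y _.
  have yq : size y == q by rewrite size_tuple; apply/eqP; exact: sumn_blocks Ll.
  by rewrite /symmetric_indic yq -sumEFin.
rewrite ge0_integral_sum//.
- by apply: eq_bigr => s _; rewrite integral_indic ?setIT.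
- by move=> s; apply/measurable_EFinP; exact: measurable_indic.
Qed.

Let h (s : 'S_N) (z : N.-tuple R[i]) : \bar R :=
  \sum_(l <- fset_set (Ltilde N q)) (symmetry_factor R l)%:E *
    nested_selection (blocks l) (porbits s) (cycle_eigenvalues z)
      (fun y => (symmetric_indic A y)%:E).

Let seq_measurable_indic : seq_measurable
  (fun (_ : N.-tuple R[i]) y => (symmetric_indic A y)%:E).
Proof.
move=> n; exact: (measurableT_comp (@measurable_symmetric_indic n) measurable_snd).
Qed.

Lemma symmetry_factor_ge0 l : (0 <= symmetry_factor R l)%R.
Proof.
by apply: prodr_ge0 => v _; rewrite mulr_ge0// ?exprn_ge0// invr_ge0.
Qed.

Let nested_ge0 (s : 'S_N) l (z : N.-tuple R[i]) :
  0 <= nested_selection (blocks l) (porbits s) (cycle_eigenvalues z)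
      (fun y => (symmetric_indic A y)%:E).
Proof.
by apply: nested_selection_ge0 => y; rewrite lee_fin symmetric_indic_ge0.
Qed.

Let measurable_nested (s : 'S_N) l : measurable_fun setT (fun z : N.-tuple R[i] =>
  nested_selection (blocks l) (porbits s) (cycle_eigenvalues z)
      (fun y => (symmetric_indic A y)%:E)).
Proof. exact: measurable_nested_selection seq_measurable_indic. Qed.

Let measurable_h s : measurable_fun setT (h s).
Proof. by apply: emeasurable_sum => l; exact: measurable_funeM. Qed.

Lemma integral_point_correlation_perm (s : 'S_N) :
  \int[iid L N]_z point_correlation q (perm_matrix (s, z)) A =
  \sum_(l <- fset_set (Ltilde N q)) (symmetry_factor R l)%:E *
    ((count_blocks R (unzip1 (blocks l)) (porbits s))%:E *
     \int[tensor L (blocks l)]_y (symmetric_indic A y)%:E).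
Proof.
under eq_integral do rewrite point_correlation_perm.
rewrite ge0_integral_sum//; last 2 first.
- by move=> l; exact: measurable_funeM.
- by move=> l z _; rewrite mule_ge0// lee_fin symmetry_factor_ge0.
rewrite big_seq [RHS]big_seq; apply: eq_bigr => l.
rewrite (in_fset_set (finite_Ltilde N q)) => /set_mem Ll.
rewrite ge0_integralZl//; last by rewrite lee_fin symmetry_factor_ge0.
congr (_ * _); have [kpos _] := Ltilde_blocks_gt0 Ll.
rewrite (integral_nested_selection hL kpos (trivIset_porbits s) seq_measurable_indic)//.
  by rewrite integral_prob_cst.
by move=> z y; rewrite lee_fin symmetric_indic_ge0.
Qed.

Let measurable_D : measurable D.
Proof.
apply: fin_bigcup_measurable; first exact: finite_finset.
by move=> s _; exact: measurable_perm_supported.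
Qed.

(** On the matrices supported on a given permutation, the eigenvalues are
    explicit functions of the entries; no measurable ordering of the
    eigenvalues of a general matrix is involved. *)
Let measurable_f_D : measurable_fun D f.
Proof.
move=> _ B mB; rewrite setI_bigcupl.
apply: fin_bigcup_measurable; first exact: finite_finset.
move=> s _; pose zM (M : 'M[R[i]]_N) := [tuple M j (s^-1%g j) | j < N].
have mz : measurable_fun setT zM.
  apply/measurable_fun_tnthP => j; rewrite (_ : _ \o _ = fun M : 'M[R[i]]_N => M j (s^-1%g j)).
    exact: measurable_entry.
  by apply/funext => M /=; rewrite tnth_mktuple.
have fE M : perm_supported s M -> f M = h s (zM M).
  by move=> sM; rewrite {1}(perm_supportedE sM); exact: point_correlation_perm.
have mhz : measurable_fun setT (h s \o zM) := measurableT_comp (measurable_h s) mz.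
rewrite (_ : _ `&` _ = perm_supported s `&` (h s \o zM) @^-1` B).
  apply: measurableI; first exact: measurable_perm_supported.
  by rewrite -[X in measurable X]setTI; exact: mhz.
apply/seteqP; split => M [sM BM]; (split; first exact: sM).
  have : B (f M) := BM; rewrite (fE M sM); exact.
by have : B (h s (zM M)) := BM; rewrite -(fE M sM); exact.
Qed.

Lemma correlation_measure_integral (theta : {posnum R}) :
  correlation_measure N q theta L A =
  \int[ewens theta]_s \int[iid L N]_z point_correlation q (perm_matrix (s, z)) A.
Proof.
have mP : measurable_fun setT (@perm_matrix R N) := measurable_funPT _.
have Dx (x : 'S_N * N.-tuple R[i]) : D (perm_matrix x).
  by case: x => s z; exists s => //; exact: perm_supported_perm_matrix.
have f0 M : 0 <= f M by exact: measure_ge0.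
have := integral_pushforward_on (ewens theta \x iid L N) mP measurable_D Dx f0 measurable_f_D.
rewrite /correlation_measure => ->.
have mfP : measurable_fun setT (fun x : 'S_N * N.-tuple R[i] => f (perm_matrix x)).
  have mg : measurable_fun setT (f \_ D) by apply/(measurable_restrictT _ measurable_D).
  rewrite (_ : (fun _ => _) = (f \_ D) \o (@perm_matrix R N)).
    exact: (measurableT_comp mg mP).
  by apply/funext => x; rewrite /comp patchE mem_set.
by rewrite fubini_tonelli1.
Qed.

Lemma integral_ewens (theta : {posnum R}) (g : 'S_N -> \bar R) :
  (forall s, 0 <= g s) ->
  \int[ewens theta]_s g s =
  (rising theta%:num N)^-1%:E * \sum_(s : 'S_N) (theta%:num ^+ #|porbits s|)%:E * g s.
Proof.
move=> g0; have mg : measurable_fun setT g by [].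
rewrite /ewens (ge0_integral_mnormalize _ (c := rising theta%:num N))//.
- rewrite ge0_integral_mfsum//; congr (_ * _); apply: eq_bigr => s _.
  by rewrite ge0_integral_mscale// integral_dirac// diracT mul1e.
- by apply: prodr_gt0 => i _; rewrite ltr_pwDl.
- rewrite /= /mfsum /mscale; under eq_bigr do rewrite /= diracT mule1.
  rewrite sumEFin; congr (_%:E); have := sum_perm_on_rising theta%:num [set: 'I_N]%SET.
  rewrite cardsT card_ord => <-; apply: eq_big => [s|s _]; last by rewrite cycles_onT.
  by apply/esym/fintype.subsetP => i _; rewrite finset.inE.
Qed.

End Correlation.
End MatrixLaw.

(** * The correlation measure *)

Section EwensConstant.
Variables (K : numFieldType) (theta : K) (theta_gt0 : 0 < theta).

Lemma rising_gt0 n : 0 < rising theta n.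
Proof. by apply: prodr_gt0 => i _; rewrite ltr_wpDr. Qed.

Lemma rising_ratio N k : (k <= N)%N ->
  (N ^_ k)%:R * rising theta (N - k) / rising theta N =
  \prod_(1 <= j < k.+1) ((N%:R + 1 - j%:R) / (N%:R + theta - j%:R)).
Proof.
have nz n : rising theta n != 0 by rewrite gt_eqF ?rising_gt0.
elim: k => [|k IHk] kN.
  by rewrite big_nil ffactn0 mul1r subn0 divff.
rewrite big_nat_recr//= -IHk; last exact: ltnW.
have -> : (N - k = (N - k.+1).+1)%N by rewrite subnS prednK// subn_gt0.
rewrite risingS ffactnSr natrM.
have -> : (N - k)%:R = N%:R + 1 - k.+1%:R :> K.
  by rewrite natrB ?(ltnW kN)// -[in RHS]natr1; ring.
have -> : N%:R + theta - k.+1%:R = theta + (N - k.+1)%:R.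
  by rewrite natrB//; ring.
have ne : theta + (N - k.+1)%:R != 0 by rewrite gt_eqF// ltr_wpDr.
by field; rewrite nz ne.
Qed.

End EwensConstant.

Local Open Scope classical_set_scope.
Local Open Scope ring_scope.
Local Open Scope ereal_scope.

Theorem proposition3p17 (R : realType) (N q : nat)
    (hN : (1 <= N)%N) (hq : (1 <= q)%N) (theta : {posnum R})
    (L : probability R[i] R) (hL : L [set 0%R] = 0)
    (A : set (q.-tuple R[i])) (hA : measurable A) :
  correlation_measure N q theta L A =
  \sum_(l \in Ltilde N q)
    ((\prod_(1 <= j < (weight l).+1)
        ((N%:R + 1 - j%:R) / (N%:R + theta%:num - j%:R)))%R *
     (\prod_(kr <- finsupp l)
        ((l kr)`!%:R^-1 * (theta%:num / (kr.2`!%:R * kr.1%:R)) ^+ l kr))%R)%:E *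
    \sum_(s : 'S_q) pushforward (tensor L (blocks l)) (permute s) A.
Proof.
(* These finite masses are real numbers, and the rest is an identity in R. *)
pose t (l : {fsfun nat * nat -> nat with 0%N}) : R :=
  fine (\sum_(s : 'S_q) pushforward (tensor L (blocks l)) (permute s) A).
have tE l : \sum_(s : 'S_q) pushforward (tensor L (blocks l)) (permute s) A = (t l)%:E.
  rewrite /t fineK//; apply/sum_fin_numP => s _ _.
  apply: fin_num_measure; rewrite -[X in measurable X]setTI.
  exact: measurable_permute.
have th0 : (0 < theta%:num)%R by [].
rewrite correlation_measure_integral// integral_ewens//; last first.
  move=> s; apply: integral_ge0 => z _; exact: measure_ge0.
rewrite fsbig_finite/=; last exact: finite_Ltilde.
have inL l : l \in fset_set (Ltilde N q) -> Ltilde N q l.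
  by rewrite (in_fset_set (finite_Ltilde N q)) => /set_mem.
rewrite (eq_bigr (fun s : 'S_N => (\sum_(l <- fset_set (Ltilde N q))
   theta%:num ^+ #|porbits s| * (symmetry_factor R l *
    (count_blocks R (unzip1 (blocks l)) (porbits s) * t l)))%:E)); last first.
  move=> s _; rewrite integral_point_correlation_perm//.
  rewrite -mulr_sumr EFinM; congr (_ * _); rewrite -sumEFin.
  rewrite big_seq [RHS]big_seq; apply: eq_bigr => l /inL Ll.
  by rewrite (integral_tensor_symmetric_indic L hA Ll) tE !EFinM.
rewrite sumEFin -EFinM; under [RHS]eq_bigr do rewrite tE -EFinM.
rewrite sumEFin; congr (_%:E); rewrite exchange_big/= mulr_sumr.
rewrite big_seq [RHS]big_seq; apply: eq_bigr => l /inL Ll.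
have [kpos _] := Ltilde_blocks_gt0 Ll.
under eq_bigr do rewrite mulrCA [X in (_ * X)%R]mulrA.
rewrite -mulr_sumr -mulr_suml.
have -> : (\sum_(s : 'S_N) theta%:num ^+ #|porbits s| *
     count_blocks R (unzip1 (blocks l)) (porbits s) =
    (N ^_ (weight l))%:R * (\prod_(kr <- finsupp l) (theta%:num / kr.1%:R) ^+ l kr) *
    rising theta%:num (N - weight l))%R.
  have := @sum_perm_on_count_blocks R theta%:num _ (unzip1 (blocks l)) [set: 'I_N]%SET.
  rewrite all_map => /(_ kpos); rewrite cardsT card_ord.
  have -> : sumn (unzip1 (blocks l)) = weight l.
    by rewrite sumnE big_map sum_blocks.
  rewrite big_map prod_blocks => <-.
  apply: eq_big => [s|s _]; last by rewrite cycles_onT.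
  by apply/esym/fintype.subsetP => i _; rewrite finset.inE.
have [_ _ lN] := Ll.
rewrite -(rising_ratio th0 lN).
have -> : (\prod_(kr <- finsupp l)
     ((l kr)`!%:R^-1 * (theta%:num / (kr.2`!%:R * kr.1%:R)) ^+ l kr) =
   symmetry_factor R l * \prod_(kr <- finsupp l) (theta%:num / kr.1%:R) ^+ l kr)%R.
  rewrite -big_split; apply: eq_bigr => kr _ /=.
  by rewrite -mulrA -exprMn; congr (_ * _ ^+ _)%R; rewrite invfM; ring.
move: (rising _ N)^-1%R => c; ring.
Qed.
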